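(* Let $\rho$ be a ray of the $c$-Cambrian fan $\mathcal F_c$. Then there is a unique simple reflection $s\in S$ and there is a $c$-singleton $w$ such that $\rho=w(\rho_s)$ and $f_c(w(\rho_s))=\mathsf{Lr}_s(w)$.
   Context: $(W,S)$ is a finite Coxeter system acting essentially on a Euclidean space $V$ with root system $\Phi$, simple roots $\{\alpha_s\}$ (a basis), positive roots $\Phi^+$, fundamental weights $\{v_s\}$ (dual basis), fundamental chamber $D=\{v:\langle v,\alpha_s\rangle\ge0\ \forall s\}$, $\rho_s=\mathbb R_{\ge0}v_s$. The Coxeter fan consists of the $w(D)$ and their faces; every ray is $w(\rho_s)$ for a uniquely determined $s$. $c$ is a Coxeter element (product of all simple reflections once; fix a reduced expression); $c_{(I)}$ is the subword with letters in $I$; the $c$-sorting word of $w$ is the lexicographically first reduced subword of $ccc\cdots$ for $w$, written $c_{(K_1)}\cdots c_{(K_p)}$, $p$ minimal; $w$ is $c$-sortable iff $K_1\supseteq\cdots\supseteq K_p$. $\pi^c_\downarrow(w)$ is the maximal $c$-sortable element below $w$ in right weak order; $w$ is a $c$-singleton iff $(\pi^c_\downarrow)^{-1}(w)=\{w\}$. $\mathcal F_c$ is the complete simplicial fan with maximal cones $C(w)=\bigcup_{\pi^c_\downarrow(w')=w}w'(D)$, $w$ $c$-sortable. For $c$-sortable $w$ with $c$-sorting word $s_1\cdots s_{\ell(w)}$, let $S(w)$ be the set of letters occurring; for $s\in S(w)$ let $j_s$ be the position of the rightmost occurrence of $s$, and set $\mathsf{Lr}_s(w)=s_1\cdots s_{j_s-1}(\alpha_s)$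 if $s\in S(w)$, $\mathsf{Lr}_s(w)=-\alpha_s$ otherwise; $\mathrm{cl}_c(w)=\{\mathsf{Lr}_s(w):s\in S\}$. $\Phi_{\ge-1}=\Phi^+\cup(-\Delta)$. $f_c$ is the bijection (Reading–Speyer) from the rays of $\mathcal F_c$ to $\Phi_{\ge-1}$ such that for every $c$-sortable $w$ the extremal rays of $C(w)$ are mapped onto $\mathrm{cl}_c(w)$. *)

(* Defs.v *)
From HB Require Import structures.
From mathcomp Require Import all_boot all_order all_algebra all_fingroup.
From mathcomp Require Import mxrepresentation.
From mathcomp Require Import all_classical reals.

Set Implicit Arguments.
Unset Strict Implicit.
Unset Printing Implicit Defensive.

Import Order.TTheory GRing.Theory Num.Theory.

Local Open Scope classical_set_scope.
Local Open Scope ring_scope.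

Section CoxeterSystem.
Variables (gT : finGroupType) (S : finType) (sr : S -> gT).

Definition weval (u : seq S) : gT := (\prod_(s <- u) sr s)%g.

Definition coxeter_matrix (m : S -> S -> nat) : Prop :=
  [/\ forall s, m s s = 1%N, forall s t, m s t = m t s
    & forall s t, s != t -> (2 <= m s t)%N].

(* The congruence on words generated by (s t)^(m s t) = 1.  As m s s = 1, every
   letter is its own inverse, so the quotient monoid is the group presented by
   these relations. *)
Inductive coxeter_cong (m : S -> S -> nat) : seq S -> seq S -> Prop :=
| Cong_rel a b s t :
    coxeter_cong m (a ++ flatten (nseq (m s t) [:: s; t]) ++ b) (a ++ b)
| Cong_refl a : coxeter_cong m a a
| Cong_sym a b : coxeter_cong m a b -> coxeter_cong m b a
| Cong_trans a b d :
    coxeter_cong m a b -> coxeter_cong m b d -> coxeter_cong m a d.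

(* The group gT is finite, so infinite entries m s t cannot occur. *)
Definition coxeter_system : Prop :=
  exists m : S -> S -> nat,
    [/\ coxeter_matrix m,
        forall g : gT, exists u, weval u = g
      & forall u v, weval u = weval v <-> coxeter_cong m u v].

Definition reduced (u : seq S) : Prop :=
  forall v, weval v = weval u -> (size u <= size v)%N.

(* Right weak order: x is a prefix of w. *)
Definition weak_le (x w : gT) : Prop :=
  exists a b, [/\ reduced (a ++ b), weval a = x & weval (a ++ b) = w].

(* Below, c is the fixed reduced expression of the Coxeter element, i.e. a word
   in which each letter of S occurs exactly once.  Positions in the infinite
   word ccc... are numbered from 0: position i carries the letter of c of index
   i %% size c.  A subword of ccc... is a strictly increasing sequence of
   positions. *)
Definition coxeter_word (c : seq S) : Prop := perm_eq c (enum S).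

Section Sorting.
Variable c : seq S.

Definition cletters (p : seq nat) : seq S :=
  pmap (fun i => onth c (i %% size c)%N) p.

Definition reduced_subword (w : gT) (p : seq nat) : Prop :=
  [/\ sorted ltn p, weval (cletters p) = w & reduced (cletters p)].

Definition first_reduced_subword (w : gT) (p : seq nat) : Prop :=
  reduced_subword w p /\
  forall q, reduced_subword w q ->
    ((p : Order.SeqLexiOrder.Exports.seqlexi nat) <= q)%O.

Definition sorting_positions (w : gT) : seq nat :=
  xget [::] [set p | first_reduced_subword w p].

Definition sorting_word (w : gT) : seq S := cletters (sorting_positions w).

(* sorting_block w i is K_(i+1): the letters of the sorting word of
   w taken from the i-th copy of c (counted from 0); it is empty for large i. *)
Definition sorting_block (w : gT) (i : nat) : {set S} :=
  [set s in cletters [seq q <- sorting_positions w | q %/ size c == i]%N]%SET.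

Definition csortable (w : gT) : Prop :=
  forall i, sorting_block w i.+1 \subset sorting_block w i.

Definition maximal_sortable_below (w x : gT) : Prop :=
  [/\ csortable x, weak_le x w
    & forall y, csortable y -> weak_le y w -> weak_le x y -> y = x].

Definition pidown (w : gT) : gT := xget 1%g [set x | maximal_sortable_below w x].

Definition csingleton (w : gT) : Prop := pidown @^-1` [set w] = [set w].

End Sorting.
End CoxeterSystem.

Section Euclidean.
Variables (R : realType) (n : nat).
Notation V := 'cV[R]_n.

Definition dot (x y : V) : R := \sum_(i < n) x i 0 * y i 0.

Definition reflection (a x : V) : V := x - (2 * dot x a / dot a a) *: a.

Definition root_system (Phi : set V) : Prop :=
  [/\ finite_set Phi,
      ~ Phi 0,
      forall a, Phi a -> forall k : R, Phi (k *: a) <-> (k = 1 \/ k = -1)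
    & forall a, Phi a -> reflection a @` Phi = Phi].

Definition halfline (x : V) : set V := [set k *: x | k in [set k : R | 0 <= k]].

Definition is_ray (F : set V) : Prop := exists2 x, x != 0 & F = halfline x.

Definition face (C F : set V) : Prop :=
  exists l : V, (forall x, C x -> 0 <= dot l x) /\
    F = C `&` [set x | dot l x = 0].

Definition extremal_rays (C : set V) : set (set V) :=
  [set F | face C F /\ is_ray F].

Section SimpleRoots.
Variables (S : finType) (alpha : S -> V) (Phi : set V).

Definition simple_system : Prop :=
  [/\ basis_of {:V}%VS (codom alpha),
      forall s, Phi (alpha s)
    & forall b, Phi b -> exists k : S -> R, b = \sum_s k s *: alpha s /\
        ((forall s, 0 <= k s) \/ (forall s, k s <= 0))].

Definition positive_roots : set V :=
  Phi `&` [set b | exists2 k : S -> R, (forall s, 0 <= k s) &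
                     b = \sum_s k s *: alpha s].

Definition almost_positive_roots : set V :=
  positive_roots `|` [set - alpha s | s in [set: S]].

Definition fundamental_weights (v : S -> V) : Prop :=
  forall s t, dot (v s) (alpha t) = (s == t)%:R.

Definition fundamental_chamber : set V :=
  [set x | forall s, 0 <= dot x (alpha s)].

End SimpleRoots.

Section Action.
Variables (gT : finGroupType) (rG : mx_representation R [set: gT]%G n).

(* On column vectors rG acts on the left: wact (x * y) = wact x \o wact y. *)
Definition wact (w : gT) (x : V) : V := rG w *m x.

Definition essential : Prop := forall x, (forall w, wact w x = x) -> x = 0.

Variables (S : finType) (sr : S -> gT) (alpha : S -> V) (Phi : set V).

Record coxeter_setup : Prop := CoxeterSetup {
  setup_coxeter : coxeter_system sr;
  setup_faithful : mx_faithful rG;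
  setup_essential : essential;
  setup_reflection : forall s x, wact (sr s) x = reflection (alpha s) x;
  setup_roots : root_system Phi;
  setup_simple : simple_system alpha Phi
}.

Variable c : seq S.

(* take (...) u is the part of the sorting word u strictly before the rightmost
   occurrence of s. *)
Definition Lr (s : S) (w : gT) : V :=
  let u := sorting_word sr c w in
  if s \in u
  then wact (weval sr (take (size u - (index s (rev u)).+1) u)) (alpha s)
  else - alpha s.

Definition cluster (w : gT) : set V := [set Lr s w | s in [set: S]].

Definition cambrian_cone (w : gT) : set V :=
  \bigcup_(w' in [set w' | pidown sr c w' = w])
    (wact w' @` fundamental_chamber alpha).

Definition cambrian_fan : set (set V) :=
  [set F | exists2 w, csortable sr c w & face (cambrian_cone w) F].

Definition cambrian_rays : set (set V) :=
  [set F | cambrian_fan F /\ is_ray F].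

(* These conditions determine f on the rays: the maximal cones containing a
   given ray intersect exactly in that ray. *)
Definition cambrian_bijection (f : set V -> V) : Prop :=
  set_bij cambrian_rays (almost_positive_roots alpha Phi) f /\
  forall w, csortable sr c w -> f @` extremal_rays (cambrian_cone w) = cluster w.

End Action.
End Euclidean.

(* Main.v *)
Require Import Defs.
From HB Require Import structures.
From mathcomp Require Import all_boot all_order all_algebra all_fingroup.
From mathcomp Require Import mxrepresentation.
From mathcomp Require Import all_classical reals.
From mathcomp Require Import ring lra zify.

Set Implicit Arguments.
Unset Strict Implicit.
Unset Printing Implicit Defensive.

Import Order.TTheory GRing.Theory Num.Theory.

Local Open Scope classical_set_scope.
Local Open Scope ring_scope.

(** Let u_k be the product of the letters kept when the first k letters of
    ccc... are read greedily along the longest element w0.  If the letter s read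
    at step k is kept, u_k and u_(k+1) = u_k s are c-singletons whose chambers
    have the same rays except for u_k(rho_s) and u_(k+1)(rho_s), and whose
    clusters have the same elements except for Lr_s(u_k) and Lr_s(u_(k+1)).
    Injectivity of f matches these up.  The labels so obtained exhaust the
    almost positive roots: -alpha_s at the first s, and every positive root as
    an inversion of w0.  Hence every ray arises in this way.

    That the u_k are c-singletons rests on the c-sortability of w0: a letter
    skipped once is skipped for ever.  Call x c-aligned if, whenever b, g and
    d = ab + eg (a, e > 0) are positive roots, omega_c(b, g) > 0 and d is an
    inversion of x, then b is an inversion of x; here omega_c is the
    skew-symmetrized Euler form.  The element w0 is c-aligned, alignment is
    preserved when c is rotated, and an aligned x which does not have the
    initial letter s of c as an inversion lies in the parabolic subgroup
    generated by the other letters. *)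

(** * Euclidean geometry *)

Section DotProduct.
Variables (R : realType) (n : nat).
Implicit Types x y z : 'cV[R]_n.

Lemma dotC x y : dot x y = dot y x.
Proof. by apply: eq_bigr => i _; rewrite mulrC. Qed.

Lemma dotDr x y z : dot x (y + z) = dot x y + dot x z.
Proof. by rewrite -big_split; apply: eq_bigr => i _; rewrite mxE mulrDr. Qed.

Lemma dotZr x k y : dot x (k *: y) = k * dot x y.
Proof. by rewrite mulr_sumr; apply: eq_bigr => i _; rewrite mxE mulrCA. Qed.

Lemma dotNr x y : dot x (- y) = - dot x y.
Proof. by rewrite -scaleN1r dotZr mulN1r. Qed.

Lemma dotBr x y z : dot x (y - z) = dot x y - dot x z.
Proof. by rewrite dotDr dotNr. Qed.

Lemma dot0r x : dot x 0 = 0.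
Proof. by rewrite -(scale0r 0) dotZr mul0r. Qed.

Lemma dotDl x y z : dot (y + z) x = dot y x + dot z x.
Proof. by rewrite dotC dotDr !(dotC x). Qed.

Lemma dotZl x k y : dot (k *: y) x = k * dot y x.
Proof. by rewrite dotC dotZr dotC. Qed.

Lemma dotNl x y : dot (- y) x = - dot y x.
Proof. by rewrite dotC dotNr dotC. Qed.

Lemma dotBl x y z : dot (y - z) x = dot y x - dot z x.
Proof. by rewrite dotDl dotNl. Qed.

Lemma dot0l x : dot 0 x = 0.
Proof. by rewrite dotC dot0r. Qed.

Lemma dot_sumr (I : finType) (P : pred I) x (F : I -> 'cV[R]_n) :
  dot x (\sum_(i | P i) F i) = \sum_(i | P i) dot x (F i).
Proof. exact: (big_morph _ (dotDr x) (dot0r x)). Qed.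

Lemma dot_suml (I : finType) (P : pred I) x (F : I -> 'cV[R]_n) :
  dot (\sum_(i | P i) F i) x = \sum_(i | P i) dot (F i) x.
Proof. by rewrite dotC dot_sumr; apply: eq_bigr => i _; rewrite dotC. Qed.

Lemma dot_eq0 x : (dot x x == 0) = (x == 0).
Proof.
apply/eqP/eqP => [x0|->]; last exact: dot0r.
apply/colP => i; rewrite mxE; apply/eqP; rewrite -sqrf_eq0 expr2; apply/eqP.
by apply: (psumr_eq0P _ x0) => // j _; rewrite -expr2 sqr_ge0.
Qed.

Lemma dot_gt0 x : x != 0 -> 0 < dot x x.
Proof.
rewrite -dot_eq0 lt_neqAle eq_sym => -> /=.
by apply: sumr_ge0 => i _; rewrite -expr2 sqr_ge0.
Qed.

Lemma reflection_isometry a x y : a != 0 ->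
  dot (reflection a x) (reflection a y) = dot x y.
Proof.
rewrite -dot_eq0 => a0; rewrite /reflection !(dotBl, dotBr, dotZl, dotZr).
by rewrite (dotC a y); field.
Qed.

End DotProduct.

(** * Roots, length and descents *)

Section Coxeter.
Variables (R : realType) (n : nat) (gT : finGroupType) (S : finType).
Variables (sr : S -> gT) (rG : mx_representation R [set: gT]%G n).
Variables (alpha v : S -> 'cV[R]_n) (Phi : set 'cV[R]_n).
Hypothesis HW : coxeter_setup rG sr alpha Phi.
Hypothesis Hv : fundamental_weights alpha v.

Notation V := 'cV[R]_n.
Notation act := (wact rG).
Notation wv := (weval sr).

Lemma wactM g h x : act (g * h)%g x = act g (act h x).
Proof. by rewrite /wact repr_mxM ?inE // mulmxA. Qed.

Lemma wact1 x : act 1%g x = x.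
Proof. by rewrite /wact repr_mx1 mul1mx. Qed.

Lemma wactD g x y : act g (x + y) = act g x + act g y.
Proof. exact: mulmxDr. Qed.

Lemma wactN g x : act g (- x) = - act g x.
Proof. exact: mulmxN. Qed.

Lemma wactB g x y : act g (x - y) = act g x - act g y.
Proof. by rewrite wactD wactN. Qed.

Lemma wactZ g k x : act g (k *: x) = k *: act g x.
Proof. by rewrite /wact scalemxAr. Qed.

Lemma wact0 g : act g 0 = 0.
Proof. exact: mulmx0. Qed.

Lemma wact_sum (I : finType) g (F : I -> V) :
  act g (\sum_i F i) = \sum_i act g (F i).
Proof. exact: mulmx_sumr. Qed.

Lemma wactK g : cancel (act g) (act g^-1%g).
Proof. by move=> x; rewrite -wactM mulVg wact1. Qed.

Lemma wactVK g : cancel (act g^-1%g) (act g).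
Proof. by move=> x; rewrite -wactM mulgV wact1. Qed.

Lemma wv_cons s u : wv (s :: u) = (sr s * wv u)%g.
Proof. exact: big_cons. Qed.

Lemma wv_nil : wv [::] = 1%g.
Proof. exact: big_nil. Qed.

Lemma wv_cat u u' : wv (u ++ u') = (wv u * wv u')%g.
Proof. exact: big_cat. Qed.

Lemma wv_seq1 s : wv [:: s] = sr s.
Proof. by rewrite wv_cons wv_nil mulg1. Qed.

Lemma wv_rcons u s : wv (rcons u s) = (wv u * sr s)%g.
Proof. by rewrite -cats1 wv_cat wv_seq1. Qed.

Lemma word_exists g : exists u, wv u = g.
Proof. by case: (setup_coxeter HW) => m []. Qed.

Lemma root_neq0 b : Phi b -> b != 0.
Proof.
by move=> Pb; apply/eqP => b0; case: (setup_roots HW) => _ []; rewrite -b0.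
Qed.

Lemma simple_root s : Phi (alpha s).
Proof. by case: (setup_simple HW). Qed.

Lemma simple_neq0 s : alpha s != 0.
Proof. exact/root_neq0/simple_root. Qed.

Lemma wact_ind (P : gT -> Prop) :
  P 1%g -> (forall s g, P g -> P (sr s * g)%g) -> forall g, P g.
Proof.
move=> P1 PM g; have [u <-] := word_exists g.
elim: u => [|s u IH]; first by rewrite wv_nil.
by rewrite wv_cons; apply: PM.
Qed.

Lemma dot_wact g x y : dot (act g x) (act g y) = dot x y.
Proof.
move: g; apply: wact_ind => [|s g IH]; first by rewrite !wact1.
by rewrite !wactM !(setup_reflection HW) reflection_isometry ?simple_neq0.
Qed.

Lemma dot_wactl g x y : dot (act g x) y = dot x (act g^-1%g y).
Proof. by rewrite -(dot_wact g^-1%g) wactK. Qed.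

Lemma root_wact g b : Phi b -> Phi (act g b).
Proof.
move: g b; apply: wact_ind => [|s g IH] b Pb; first by rewrite wact1.
rewrite wactM (setup_reflection HW).
case: (setup_roots HW) => _ _ _ /(_ _ (simple_root s)) <-.
by exists (act g b) => //; apply: IH.
Qed.

Lemma rootN b : Phi b -> Phi (- b).
Proof.
move=> Pb; case: (setup_roots HW) => _ _ /(_ _ Pb (-1)) [_ H] _.
by rewrite -scaleN1r; apply: H; right.
Qed.

(** As [v] is the basis dual to [alpha], this pairing extracts the coefficient of [alpha s] in
    [x]. *)
Definition simple_coef s x : R := dot (v s) x.
Notation co := simple_coef.

Lemma span_simple x : exists k : S -> R, x = \sum_s k s *: alpha s.
Proof.
have : x \in <<[seq alpha s | s <- enum S]>>%VS.
  by case: (setup_simple HW) => /andP[/eqP -> _] _ _; rewrite memvf.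
elim: (enum S) x => [|s l IH] x /=.
  rewrite span_nil memv0 => /eqP ->; exists (fun=> 0).
  by rewrite big1 // => s _; rewrite scale0r.
rewrite span_cons => /memv_addP [_ /vlineP[a ->] [y /IH[k ->] ->]].
exists (fun t => (if t == s then a else 0) + k t).
under [RHS]eq_bigr => t _ do rewrite scalerDl.
rewrite big_split /=; congr (_ + _).
rewrite (bigD1 s) //= eqxx big1 ?addr0 // => t /negPf ->.
exact: scale0r.
Qed.

Lemma sum_delta (F : S -> R) s : \sum_t F t * (s == t)%:R = F s.
Proof.
rewrite (bigD1 s) //= eqxx mulr1 big1 ?addr0 // => t.
by rewrite eq_sym => /negPf ->; rewrite mulr0.
Qed.

Lemma coD s x y : co s (x + y) = co s x + co s y. Proof. exact: dotDr. Qed.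
Lemma coB s x y : co s (x - y) = co s x - co s y. Proof. exact: dotBr. Qed.
Lemma coN s x : co s (- x) = - co s x. Proof. exact: dotNr. Qed.
Lemma coZ s k x : co s (k *: x) = k * co s x. Proof. exact: dotZr. Qed.
Lemma co_simple s t : co s (alpha t) = (s == t)%:R. Proof. exact: Hv. Qed.

Lemma co_comb (k : S -> R) s : co s (\sum_t k t *: alpha t) = k s.
Proof.
rewrite /co dot_sumr; under eq_bigr => t _ do rewrite dotZr Hv.
exact: sum_delta.
Qed.

Lemma co_expand x : x = \sum_s co s x *: alpha s.
Proof.
have [k xE] := span_simple x; rewrite {1}xE; apply: eq_bigr => s _.
by rewrite xE co_comb.
Qed.

(** On roots this is a boolean test for positivity; [root_sign] gives the dichotomy. *)
Definition nonneg (x : V) : bool := [forall s, 0 <= co s x].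
Notation pos := nonneg.

Lemma nonnegP x : reflect (forall s, 0 <= co s x) (pos x).
Proof. exact: forallP. Qed.

Lemma nonneg_simple s : pos (alpha s).
Proof. by apply/nonnegP => t; rewrite co_simple ler0n. Qed.

Lemma nonneg_lin a e x y : 0 <= a -> 0 <= e -> pos x -> pos y ->
  pos (a *: x + e *: y).
Proof.
move=> a0 e0 /nonnegP px /nonnegP py; apply/nonnegP => s.
by rewrite coD !coZ addr_ge0 // mulr_ge0.
Qed.

Lemma root_sign b : Phi b -> pos (- b) = ~~ pos b.
Proof.
move=> Pb; have b0 := root_neq0 Pb.
have E : pos b || pos (- b).
  case: (setup_simple HW) => _ _ /(_ _ Pb) [k [-> [k0|k0]]]; apply/orP.
    by left; apply/nonnegP => s; rewrite co_comb.
  by right; apply/nonnegP => s; rewrite coN co_comb oppr_ge0.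
have [pb|pb] /= := boolP (pos b); last by move: E; rewrite (negPf pb).
apply/negP => pNb; case/eqP: b0; rewrite (co_expand b) big1 // => s _.
move/nonnegP/(_ s): pb; move/nonnegP/(_ s): pNb; rewrite coN oppr_ge0 => h1 h2.
by rewrite (@le_anti _ _ (co s b) 0) ?h1 // scale0r.
Qed.

Lemma root_co_gt0 b s : Phi b -> 0 < co s b -> pos b.
Proof.
move=> Pb b0; apply: contraLR b0; rewrite -root_sign // => /nonnegP/(_ s).
by rewrite coN oppr_ge0 -leNgt.
Qed.

Lemma wact_simpleE s x :
  act (sr s) x = x - (2 * dot x (alpha s) / dot (alpha s) (alpha s)) *: alpha s.
Proof. exact: (setup_reflection HW). Qed.

Lemma wact_simple s : act (sr s) (alpha s) = - alpha s.
Proof.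
have := simple_neq0 s; rewrite -dot_eq0 wact_simpleE => a0.
by rewrite mulfK // scaler_nat mulr2n opprD addNKr.
Qed.

Lemma wact_inj g h : (forall x, act g x = act h x) -> g = h.
Proof.
move=> gh; apply: (mx_faithful_inj (setup_faithful HW)); rewrite ?inE //.
apply/matrixP => i j; have : col j (rG g) = col j (rG h).
  by rewrite !colE; apply: gh.
by move/colP/(_ i); rewrite !mxE.
Qed.

Lemma sr2 s : (sr s * sr s)%g = 1%g.
Proof.
apply: wact_inj => x; rewrite wact1 wactM.
rewrite [act _ x]wact_simpleE wactB wactZ wact_simple wact_simpleE.
by rewrite scalerN opprK subrK.
Qed.

Lemma srV s : (sr s)^-1%g = sr s.
Proof. by apply: (mulgI (sr s)); rewrite sr2 mulgV. Qed.

Lemma co_wact_simple s t x : t != s -> co t (act (sr s) x) = co t x.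
Proof.
by move=> ts; rewrite wact_simpleE coB coZ co_simple (negPf ts) mulr0 subr0.
Qed.

(** The reflection changes only the coefficient of [alpha s]. A positive root made negative would
    thus be a multiple of [alpha s], hence [alpha s] itself. *)
Lemma nonneg_wact_simple s b : Phi b -> pos b -> b != alpha s ->
  pos (act (sr s) b).
Proof.
move=> Pb pb bs; apply/negPn/negP; rewrite -root_sign; last exact: root_wact.
move=> /nonnegP Nb; case/eqP: bs.
have co0 t : t != s -> co t b = 0.
  move=> ts; move/nonnegP/(_ t): pb; move: (Nb t).
  rewrite coN co_wact_simple // oppr_ge0 => h1 h2.
  by apply/eqP; rewrite eq_le h1.
have bE : b = co s b *: alpha s.
  by rewrite {1}(co_expand b) (bigD1 s) //= big1 ?addr0 // => t /co0->;
    rewrite scale0r.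
case: (setup_roots HW) => _ _ /(_ _ (simple_root s) (co s b)) [+ _] _.
rewrite -bE => /(_ Pb) [E|E]; first by rewrite bE E scale1r.
by move/nonnegP/(_ s): pb; rewrite E oppr_ge0 leNgt ltr01.
Qed.

Lemma simple_dot_le0 s t : s != t -> dot (alpha s) (alpha t) <= 0.
Proof.
move=> st; have /nonnegP/(_ s) : pos (act (sr s) (alpha t)).
  rewrite nonneg_wact_simple ?nonneg_simple //; first exact: simple_root.
  apply/eqP => E; have := co_simple s t; rewrite E co_simple eqxx (negPf st).
  by move/eqP; rewrite oner_eq0.
rewrite wact_simpleE coB coZ !co_simple (negPf st) eqxx mulr1 sub0r oppr_ge0.
rewrite dotC pmulr_lle0 ?invr_gt0 ?dot_gt0 ?simple_neq0 //.
by rewrite pmulr_rle0.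
Qed.

Lemma conj_simple g s r : act g (alpha s) = alpha r ->
  (g * sr s)%g = (sr r * g)%g.
Proof.
move=> gs; apply: wact_inj => x; rewrite !wactM !wact_simpleE wactB wactZ gs.
by rewrite -gs !dot_wact.
Qed.

(** Apply the letters of [u] to [alpha s] from right to left. Where the root first turns negative it
    was the simple root of the letter being applied, and by [conj_simple] deleting that letter
    amounts to multiplying by [s]. *)
Lemma exchange u s : ~~ pos (act (wv u) (alpha s)) ->
  exists u', wv u' = (wv u * sr s)%g /\ size u = (size u').+1.
Proof.
elim: u => [|a u IH]; first by rewrite wv_nil wact1 nonneg_simple.
rewrite wv_cons wactM => H.
have [pb|/IH[u' [E1 E2]]] := boolP (pos (act (wv u) (alpha s))); last first.
  by exists (a :: u'); rewrite wv_cons E1 mulgA /= E2.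
have Pb : Phi (act (wv u) (alpha s)) by apply/root_wact/simple_root.
have [/conj_simple E|E] := eqVneq (act (wv u) (alpha s)) (alpha a).
  by exists u; rewrite -mulgA E mulgA sr2 mul1g.
by rewrite nonneg_wact_simple in H.
Qed.

Lemma len_exists g : exists k, `[< exists u, wv u = g /\ size u = k >].
Proof.
by have [u gu] := word_exists g; exists (size u); apply/asboolP;
  exists u.
Qed.

Definition len g : nat := ex_minn (len_exists g).

Lemma len_word g : exists u, wv u = g /\ size u = len g.
Proof. by rewrite /len; case: ex_minnP => k /asboolP. Qed.

Lemma len_min u : (len (wv u) <= size u)%N.
Proof.
by rewrite /len; case: ex_minnP => k _; apply; apply/asboolP; exists u.
Qed.

Lemma reducedE u : reduced sr u <-> size u = len (wv u).
Proof.
split=> [ru|E u' E'].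
  have [u' [E E']] := len_word (wv u); apply/eqP; rewrite eqn_leq len_min andbT.
  by rewrite -E' ru.
by rewrite E -E' len_min.
Qed.

Lemma len1 : len 1 = 0%N.
Proof. by apply/eqP; rewrite -leqn0 -wv_nil (leq_trans (len_min _)). Qed.

Lemma len_eq0 g : len g = 0%N -> g = 1%g.
Proof.
by have [u [<- <-]] := len_word g => /size0nil ->; rewrite wv_nil.
Qed.

Lemma lenM g h : (len (g * h) <= len g + len h)%N.
Proof.
have [u [<- <-]] := len_word g; have [u' [<- <-]] := len_word h.
by rewrite -wv_cat -size_cat len_min.
Qed.

Lemma wv_rev u : wv (rev u) = (wv u)^-1%g.
Proof.
elim: u => [|s u IH]; first by rewrite wv_nil invg1.
by rewrite rev_cons wv_rcons wv_cons IH invMg srV.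
Qed.

Lemma lenV g : len g^-1 = len g.
Proof.
have H h : (len h^-1 <= len h)%N.
  by have [u [<- <-]] := len_word h; rewrite -wv_rev -(size_rev u) len_min.
by apply/eqP; rewrite eqn_leq H -{1}(invgK g) H.
Qed.

Lemma len_sr s : (len (sr s) <= 1)%N.
Proof. by rewrite -wv_seq1 len_min. Qed.

Lemma len_desc g s : ~~ pos (act g (alpha s)) -> len g = (len (g * sr s)).+1.
Proof.
have [u [<- E]] := len_word g => /exchange[u' [E1 E2]].
apply/eqP; rewrite eqn_leq -{2}E E2 ltnS -E1 len_min andbT E1.
rewrite -{1}[wv u](mulgK (sr s)) srV; apply: leq_trans (lenM _ _) _.
by rewrite -addn1 leq_add2l len_sr.
Qed.

Lemma len_asc g s : pos (act g (alpha s)) -> len (g * sr s) = (len g).+1.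
Proof.
move=> pg; rewrite (@len_desc (g * sr s)%g s) -?mulgA ?sr2 ?mulg1 //.
rewrite wactM wact_simple wactN root_sign ?pg //.
exact/root_wact/simple_root.
Qed.

Definition ldesc s g : bool := ~~ pos (act g^-1%g (alpha s)).

Lemma len_ldesc g s : ldesc s g -> len g = (len (sr s * g)).+1.
Proof.
by move/len_desc; rewrite lenV => ->; rewrite -[in RHS]lenV invMg srV.
Qed.

Lemma len_lasc g s : ~~ ldesc s g -> len (sr s * g) = (len g).+1.
Proof.
by move/negPn/len_asc; rewrite lenV => <-; rewrite -[LHS]lenV invMg srV.
Qed.

Lemma ldesc_exists g : g != 1%g -> exists s, ldesc s g.
Proof.
have [[|s u] [gE gl]] := len_word g; first by rewrite -gE wv_nil eqxx.
move=> _; exists s; apply: contraT => /len_lasc.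
rewrite -gl -gE wv_cons mulgA sr2 mul1g => E.
by have := len_min u; rewrite E /= ltnNge leqnSn.
Qed.

Lemma reduced_rcons u s : reduced sr u ->
  reduced sr (rcons u s) <-> pos (act (wv u) (alpha s)).
Proof.
move=> /reducedE ru; split=> [/reducedE|p].
  rewrite wv_rcons size_rcons ru => E; apply/negPn/negP => /len_desc.
  by rewrite -E; lia.
by apply/reducedE; rewrite wv_rcons size_rcons len_asc // ru.
Qed.

Lemma reduced_catl u u' : reduced sr (u ++ u') -> reduced sr u.
Proof.
move=> /reducedE; rewrite size_cat wv_cat => E; apply/reducedE/eqP.
rewrite eqn_leq len_min andbT -(leq_add2r (size u')) E.
by apply: leq_trans (lenM _ _) _; rewrite leq_add2l len_min.
Qed.

Lemma reduced_catr u u' : reduced sr (u ++ u') -> reduced sr u'.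
Proof.
move=> /reducedE; rewrite size_cat wv_cat => E; apply/reducedE/eqP.
rewrite eqn_leq len_min andbT -(leq_add2l (size u)) E.
by apply: leq_trans (lenM _ _) _; rewrite leq_add2r len_min.
Qed.

Lemma ldesc_cons s u : reduced sr (s :: u) -> ldesc s (wv (s :: u)).
Proof.
move=> /reducedE E; apply: contraT => /len_lasc.
rewrite -E wv_cons mulgA sr2 mul1g => E'.
by have := len_min u; rewrite E' /=; lia.
Qed.

Lemma ldesc_cat s u u' : reduced sr (u ++ u') -> ldesc s (wv u) ->
  ldesc s (wv (u ++ u')).
Proof.
move=> /reducedE E d; apply: contraT => /len_lasc.
rewrite -E wv_cat mulgA => E'; have := lenM (sr s * wv u) (wv u').
have := len_ldesc d; have := len_min u; have := len_min u'.
by rewrite E' size_cat; lia.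
Qed.

Lemma len_max : exists w0, forall g, (len g <= len w0)%N.
Proof.
exists [arg max_(g > 1%g) len g]%N => g.
by case: arg_maxnP => // i _; apply.
Qed.

(** An element of maximal length makes every simple root negative, hence every nonnegative
    combination of them nonpositive. *)
Lemma longest_exists :
  exists w0, forall b, Phi b -> pos b -> ~~ pos (act w0^-1%g b).
Proof.
have [w0 w0max] := len_max.
have neg s : pos (- act w0 (alpha s)).
  rewrite root_sign; last exact/root_wact/simple_root.
  by apply/negP => /len_asc E; have := w0max (w0 * sr s)%g; rewrite E ltnn.
exists w0 => b Pb pb; apply/negP => p.
have : pos (- b).
  apply/nonnegP => t; rewrite -(wactVK w0 b) -wactN.
  rewrite (co_expand (act w0^-1%g b)) -sumrN wact_sum /co dot_sumr.
  apply: sumr_ge0 => s _; rewrite -scalerN wactZ dotZr mulr_ge0 //.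
    by have /nonnegP := p; apply.
  by rewrite wactN; have /nonnegP := neg s; apply.
by rewrite root_sign ?pb.
Qed.

(** * Maximal standard parabolic subgroups *)

Lemma co_wact_notin u s x : s \notin u -> co s (act (wv u) x) = co s x.
Proof.
elim: u => [|a u IH]; first by rewrite wv_nil wact1.
rewrite in_cons negb_or => /andP[sa su].
by rewrite wv_cons wactM co_wact_simple // IH.
Qed.

(** Membership in the parabolic subgroup generated by the letters other than [s]. *)
Definition avoids s g : Prop := exists2 u, wv u = g & s \notin u.

Lemma avoids1 s : avoids s 1%g.
Proof. by exists [::] => //; rewrite wv_nil. Qed.

Lemma avoidsV s g : avoids s g -> avoids s g^-1%g.
Proof. by case=> u <- su; exists (rev u); rewrite ?wv_rev ?mem_rev. Qed.

Lemma avoidsM s g h : avoids s g -> avoids s h -> avoids s (g * h)%g.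
Proof.
move=> [u <- su] [u' <- su']; exists (u ++ u'); first by rewrite wv_cat.
by rewrite mem_cat negb_or su.
Qed.

Lemma avoids_sr s t : s != t -> avoids s (sr t).
Proof. by move=> st; exists [:: t]; rewrite ?wv_seq1 // inE. Qed.

Lemma co_avoids s g x : avoids s g -> co s (act g x) = co s x.
Proof. by case=> u <-; apply: co_wact_notin. Qed.

Lemma avoids_nonneg s g b : avoids s g -> Phi b -> 0 < co s b -> pos (act g b).
Proof.
move=> sg Pb b0; apply: (@root_co_gt0 _ s); first exact: root_wact.
by rewrite co_avoids.
Qed.

Lemma avoids_simple s g : avoids s g -> pos (act g (alpha s)).
Proof.
move=> sg; apply: (avoids_nonneg sg (simple_root s)).
by rewrite co_simple eqxx ltr01.
Qed.

Lemma avoids_ldesc s g : avoids s g -> ~~ ldesc s g.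
Proof. by move/avoidsV/avoids_simple; rewrite /ldesc negbK. Qed.

(** The first letter of a reduced word is a left descent, and no element of the parabolic subgroup
    has [s] as one; strip that letter and repeat. *)
Lemma avoids_notin s u : reduced sr u -> avoids s (wv u) -> s \notin u.
Proof.
elim: u => [|a u IH] // ru au.
have ru' : reduced sr u by apply: (@reduced_catr [:: a]).
have sa : s != a.
  by apply/eqP => sa; have := avoids_ldesc au; rewrite sa ldesc_cons.
rewrite in_cons negb_or sa IH //.
have -> : wv u = (sr a * wv (a :: u))%g by rewrite wv_cons mulgA sr2 mul1g.
exact/avoidsM/au/avoids_sr.
Qed.

(** Left descents other than [s] are stripped one at a time and collected in [y]; [z] is the minimal
    representative of the coset. *)
Lemma parabolic_decomp s x : exists y z,
  [/\ x = (y * z)%g, avoids s y, forall r, r != s -> ~~ ldesc r z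
    & len x = (len y + len z)%N].
Proof.
move: {2}(len x) (leqnn (len x)) => m; elim: m x => [|m IH] x.
  rewrite leqn0 => /eqP/len_eq0 ->; exists 1%g, 1%g; split;
    rewrite ?mulg1 ?len1 //.
    exact: avoids1.
  by move=> r _; apply/avoids_ldesc/avoids1.
move=> xm; have [/existsP[r /andP[rs rx]]|/existsPn no] :=
    boolP [exists r, (r != s) && ldesc r x]; last first.
  exists 1%g, x; split; rewrite ?mul1g ?len1 //; first exact: avoids1.
  by move=> r rs; have := no r; rewrite rs.
have E := len_ldesc rx.
have [|y [z [E1 E2 E3 E4]]] := IH (sr r * x)%g; first by move: xm; rewrite E.
have xE : x = (sr r * y * z)%g by rewrite -mulgA -E1 mulgA sr2 mul1g.
exists (sr r * y)%g, z; split=> //.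
  by apply: avoidsM E2; apply: avoids_sr; rewrite eq_sym.
apply/eqP; rewrite eqn_leq {1}xE lenM /=.
have := lenM (sr r) y; have := len_sr r; lia.
Qed.

(** * The skew form and aligned elements *)

(* The sign of a pair depends only on which of its letters comes first in c:
   this is the skew-symmetrization of the Euler form of the Coxeter element. *)
Definition eps (c : seq S) s t : R :=
  (index t c < index s c)%N%:R - (index s c < index t c)%N%:R.

Definition skew (c : seq S) (x y : V) : R :=
  \sum_s \sum_t eps c s t * co s x * co t y * dot (alpha s) (alpha t).
Notation om := skew.

Lemma skewDl c x y z : om c (x + y) z = om c x z + om c y z.
Proof.
rewrite -big_split; apply: eq_bigr => s _; rewrite -big_split.
by apply: eq_bigr => t _; rewrite coD /=; ring.
Qed.

Lemma skewZl c k x z : om c (k *: x) z = k * om c x z.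
Proof.
rewrite mulr_sumr; apply: eq_bigr => s _; rewrite mulr_sumr.
by apply: eq_bigr => t _; rewrite coZ; ring.
Qed.

Lemma skew_anti c x y : om c x y = - om c y x.
Proof.
rewrite /om exchange_big -sumrN; apply: eq_bigr => s _; rewrite -sumrN.
apply: eq_bigr => t _; rewrite (dotC (alpha s)) /eps; ring.
Qed.

Lemma skewDr c x y z : om c z (x + y) = om c z x + om c z y.
Proof. by rewrite !(skew_anti c z) skewDl opprD. Qed.

Lemma skewZr c k x z : om c z (k *: x) = k * om c z x.
Proof. by rewrite !(skew_anti c z) skewZl mulrN. Qed.

Lemma skewxx c x : om c x x = 0.
Proof. by have := skew_anti c x x; lra. Qed.

Lemma skew_simple c s x :
  om c (alpha s) x = \sum_t eps c s t * co t x * dot (alpha s) (alpha t).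
Proof.
rewrite /om (bigD1 s) //= [X in _ + X]big1 ?addr0.
  by apply: eq_bigr => t _; rewrite co_simple eqxx mulr1.
move=> t ts; rewrite big1 // => r _.
by rewrite co_simple (negPf ts) mulr0 !mul0r.
Qed.

Lemma dot_co x y : dot x y = \sum_t co t y * dot x (alpha t).
Proof.
by rewrite {1}(co_expand y) dot_sumr; apply: eq_bigr => t _; rewrite dotZr.
Qed.

Lemma skew_initial s c x : co s x = 0 ->
  om (s :: c) (alpha s) x = - dot (alpha s) x.
Proof.
move=> x0; rewrite skew_simple (dot_co _ x) -sumrN; apply: eq_bigr => t _.
have [->|ts] := eqVneq t s; first by rewrite x0 mulr0 !mul0r oppr0.
by rewrite /eps /= eqxx eq_sym (negPf ts) /= sub0r !mulNr mul1r.
Qed.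

Lemma coxeter_mem (c : seq S) t : coxeter_word c -> t \in c.
Proof. by move/perm_mem->; rewrite mem_enum. Qed.

Lemma coxeter_uniq (c : seq S) : coxeter_word c -> uniq c.
Proof. by move/perm_uniq->; rewrite enum_uniq. Qed.

Lemma skew_final s c x : coxeter_word (s :: c) -> co s x = 0 ->
  om (rcons c s) (alpha s) x = dot (alpha s) x.
Proof.
move=> cw x0; rewrite skew_simple (dot_co _ x); apply: eq_bigr => t _.
have [->|ts] := eqVneq t s; first by rewrite x0 !mulr0 !mul0r.
have tc : t \in c.
  by have := coxeter_mem t cw; rewrite in_cons (negPf ts).
have sc : s \notin c by case/andP: (coxeter_uniq cw).
rewrite /eps -!cats1 !index_cat tc (negPf sc) /= eqxx addn0 index_mem tc.
by rewrite ltnNge index_size /= subr0 mul1r.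
Qed.

Lemma skew_rot s c x y : coxeter_word (s :: c) -> co s x = 0 -> co s y = 0 ->
  om (rcons c s) x y = om (s :: c) x y.
Proof.
move=> cw x0 y0; apply: eq_bigr => a _; apply: eq_bigr => b _.
have [->|as_] := eqVneq a s; first by rewrite x0 !mulr0 !mul0r.
have [->|bs] := eqVneq b s; first by rewrite y0 !mulr0 !mul0r.
have mc t : t != s -> t \in c.
  by move=> ts; have := coxeter_mem t cw; rewrite in_cons (negPf ts).
rewrite /eps -!cats1 !index_cat !mc //= ![s == _]eq_sym.
by rewrite (negPf as_) (negPf bs) !ltnS.
Qed.

(** Split each vector into a multiple of [alpha s] and a combination of the other simple roots. On
    the latter both words give the same form; against [alpha s] they give minus and plus the scalar
    product, and the reflection makes up for this sign. *)
Lemma skew_wact s c x y : coxeter_word (s :: c) ->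
  om (s :: c) (act (sr s) x) (act (sr s) y) = om (rcons c s) x y.
Proof.
move=> cw.
have split_ z : exists z' k, co s z' = 0 /\ z = k *: alpha s + z'.
  exists (z - co s z *: alpha s), (co s z).
  by rewrite coB coZ co_simple eqxx mulr1 subrr addrC subrK.
have [x' [p [x0 ->]]] := split_ x; have [y' [q [y0 ->]]] := split_ y.
have actE k z : act (sr s) (k *: alpha s + z) =
   (- k - 2 * dot z (alpha s) / dot (alpha s) (alpha s)) *: alpha s + z.
  rewrite wactD wactZ wact_simple wact_simpleE scalerBl scaleNr scalerN.
  by rewrite addrCA addrC -!addrA [- _ + z]addrC.
rewrite !actE !(skewDl, skewDr, skewZl, skewZr) !skewxx.
rewrite (skew_anti _ x') (skew_anti _ x' (alpha s)) !skew_initial // !skew_final //.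
rewrite skew_rot // !(dotC _ (alpha s)).
have := simple_neq0 s; rewrite -dot_eq0 => a0; field.
exact: a0.
Qed.

Lemma skew_initial_ge0 s c x : pos x -> 0 <= om (s :: c) (alpha s) x.
Proof.
move=> /nonnegP px; rewrite skew_simple; apply: sumr_ge0 => t _.
have [->|ts] := eqVneq t s; first by rewrite /eps ltnn subrr !mul0r.
rewrite /eps /= eqxx eq_sym (negPf ts) /= sub0r !mulNr mul1r -mulrN.
by rewrite mulr_ge0 // oppr_ge0 simple_dot_le0 // eq_sym.
Qed.

(** For a positive root [b], [~~ pos (act x^-1%g b)] says that [b] is an inversion of [x]. *)
Definition aligned (c : seq S) x : Prop :=
  forall b g (a e : R), Phi b -> Phi g -> pos b -> pos g -> 0 < a -> 0 < e ->
    Phi (a *: b + e *: g) -> 0 < om c b g ->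
    ~~ pos (act x^-1%g (a *: b + e *: g)) -> ~~ pos (act x^-1%g b).

Lemma skew_final_le0 s c b : coxeter_word (s :: c) -> Phi b -> pos b ->
  om (rcons c s) (alpha s) b <= 0.
Proof.
move=> cw Pb pb; have [->|bs] := eqVneq b (alpha s); first by rewrite skewxx.
rewrite -skew_wact // wact_simple -scaleN1r skewZl mulN1r oppr_le0.
exact/skew_initial_ge0/nonneg_wact_simple.
Qed.

(** Apart from [alpha s], the reflection permutes the positive roots, and [skew_wact] transports the
    form. If [b] is [alpha s], the form is not positive; if [g] is, then [x^-1] sends [s g] to a
    positive root, so only [s b] can account for the inversion. *)
Lemma aligned_fire s c x : coxeter_word (s :: c) -> aligned (s :: c) x ->
  ldesc s x -> aligned (rcons c s) (sr s * x)%g.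
Proof.
move=> cw al sx b g a e Pb Pg pb pg a0 e0 Pd o0.
rewrite invMg srV !wactM => nd.
have [bs|bs] := eqVneq b (alpha s).
  by move: o0; rewrite bs ltNge skew_final_le0.
have [gs|gs] := eqVneq g (alpha s).
  apply: contra nd => px; rewrite !wactD !wactZ; apply: nonneg_lin => //;
    try exact: ltW.
  by rewrite gs wact_simple wactN root_sign //; apply/root_wact/simple_root.
apply: (al _ (act (sr s) g) a e) => //.
- exact: root_wact.
- exact: root_wact.
- exact: nonneg_wact_simple.
- exact: nonneg_wact_simple.
- by rewrite -!wactZ -wactD; apply: root_wact.
- by rewrite skew_wact.
- by rewrite -!wactZ -wactD.
Qed.

Lemma co_lin_eq0 s b g (a e : R) : pos b -> pos g -> 0 < a -> 0 < e ->
  co s (a *: b + e *: g) <= 0 -> co s b = 0 /\ co s g = 0.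
Proof.
move=> /nonnegP/(_ s) b0 /nonnegP/(_ s) g0 a0 e0; rewrite coD !coZ => H.
have := mulr_ge0 (ltW e0) g0; have := mulr_ge0 (ltW a0) b0 => h1 h2.
split; apply/eqP; rewrite eq_le ?b0 ?g0 andbT.
  by rewrite -(pmulr_rle0 _ a0); lra.
by rewrite -(pmulr_rle0 _ e0); lra.
Qed.

Lemma avoids_inv_co s x b : avoids s x -> Phi b -> ~~ pos (act x^-1%g b) ->
  co s b <= 0.
Proof.
move=> sx Pb nb; rewrite leNgt; apply: contra nb => b0.
exact: (avoids_nonneg (avoidsV sx) Pb b0).
Qed.

(** An inversion of an element of the parabolic subgroup has no [alpha s] component. Neither do [b]
    and [g] then, and on such roots the two forms agree. *)
Lemma aligned_skip s c x : coxeter_word (s :: c) -> aligned (s :: c) x ->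
  avoids s x -> aligned (rcons c s) x.
Proof.
move=> cw al sx b g a e Pb Pg pb pg a0 e0 Pd o0 nd.
have [b0 g0] := co_lin_eq0 pb pg a0 e0 (avoids_inv_co sx Pd nd).
by apply: (al b g a e) => //; rewrite -skew_rot.
Qed.

(* The words read off from ccc... by taking or dropping each letter in turn,
   where a dropped letter is never taken again. *)
Inductive sort_word : seq S -> seq S -> Prop :=
| sort_nil c : sort_word c [::]
| sort_fire s c w : sort_word (rcons c s) w -> sort_word (s :: c) (s :: w)
| sort_skip s c w : s \notin w -> sort_word (rcons c s) w -> sort_word (s :: c) w.

Lemma sort_word_catl c u u' : sort_word c (u ++ u') -> sort_word c u.
Proof.
move: {2}(u ++ u') (erefl (u ++ u')) => w E; rewrite E => H.
elim: H u u' E => {c w} [c|s c w _ IH|s c w sw _ IH] u u' E.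
- by case: u E => // _; exact: sort_nil.
- by case: u E => [_|_ u [-> E]]; [exact: sort_nil|apply/sort_fire/IH/E].
- apply: sort_skip; last exact/IH/E.
  by move: sw; rewrite -E mem_cat negb_or => /andP[].
Qed.

Lemma coxeter_word_rot s (c : seq S) :
  coxeter_word (s :: c) -> coxeter_word (rcons c s).
Proof. by rewrite /coxeter_word -cats1 perm_catC. Qed.

Definition drop_coef s x : V := x - co s x *: alpha s.

Lemma co_drop_coef s x : co s (drop_coef s x) = 0.
Proof. by rewrite coB coZ co_simple eqxx mulr1 subrr. Qed.

Lemma dot_drop_coef_le0 s x : pos x -> dot (alpha s) (drop_coef s x) <= 0.
Proof.
move=> /nonnegP px; rewrite dot_co sumr_le0 // => t _.
have [->|ts] := eqVneq t s; first by rewrite co_drop_coef mul0r.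
rewrite mulr_ge0_le0 ?simple_dot_le0 1?eq_sym //.
by rewrite coB coZ co_simple (negPf ts) mulr0 subr0.
Qed.

(** Pulling back along [a] adds a multiple of [alpha a] to [p - alpha s], because [a] moves
    [alpha s]. The last summand is the pairing of that multiple with [q], [a] being final in the
    rotated word. *)
Lemma skew_fire a c s p q : coxeter_word (a :: c) ->
  om (a :: c) (act (sr a) p - alpha s) (act (sr a) q) =
  om (rcons c a) (p - alpha s) q +
    2 * dot (alpha s) (alpha a) / dot (alpha a) (alpha a) *
      dot (alpha a) (drop_coef a q).
Proof.
move=> cw; set k : R := _ / _.
have -> : act (sr a) p - alpha s = act (sr a) (p - alpha s + k *: alpha a).
  rewrite wactD wactZ wact_simple wactB [in RHS]wact_simpleE [in RHS]wact_simpleE.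
  rewrite -/k [in LHS]wact_simpleE scalerN opprD opprK -!addrA; congr (_ + _).
  by congr (_ + _); rewrite subrr addr0.
rewrite skew_wact // skewDl skewZl; congr (_ + _ * _).
rewrite -{1}(subrK (co a q *: alpha a) q) -/(drop_coef a q) skewDr skewZr skewxx.
by rewrite mulr0 addr0 skew_final // co_drop_coef.
Qed.

(* Peel off the first letter a of y: by [skew_fire], G grows by a nonnegative
   amount, which is positive when a is the last r of y, since otherwise r y' r
   would not be reduced for the remainder y'. *)
Lemma skew_sort_word c s y r : coxeter_word c -> sort_word c (rcons y r) ->
  reduced sr (rcons y r) -> s \notin rcons y r -> dot (alpha s) (alpha r) < 0 ->
  let G := om c (act (wv y) (alpha s) - alpha s) (act (wv y) (alpha r)) in
  0 <= G /\ (r \in y -> 0 < G).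
Proof.
move: {2}(rcons y r) (erefl (rcons y r)) => w E cw H; rewrite E in H *.
have om0 c' z : om c' 0 z = 0 by rewrite -(scale0r 0) skewZl mul0r.
elim: H y E cw => {c w} [c|a c w _ IH|a c w aw _ IH] y E cw rw sw sr0.
- by case: y E.
- have cw' := coxeter_word_rot cw.
  case: y E => [|a' y] [aE E].
    by rewrite wv_nil !wact1 !subrr om0.
  subst a'; have rw' : reduced sr w by apply: (@reduced_catr [:: a]).
  have py : pos (act (wv y) (alpha r)).
    by apply/reduced_rcons; [apply: (@reduced_catl _ [:: r])|];
      rewrite ?cats1 E.
  have pay : pos (act (wv (a :: y)) (alpha r)).
    by apply/reduced_rcons; [apply: (@reduced_catl _ [:: r])|];
      rewrite ?cats1 /= E.
  move: sw; rewrite in_cons negb_or => /andP[sa sw].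
  have [] := IH _ E cw' rw' sw sr0.
  rewrite wv_cons !wactM skew_fire //; set q := act (wv y) (alpha r).
  move=> G0 G1.
  have aa := dot_gt0 (simple_neq0 a).
  have k0 : 2 * dot (alpha s) (alpha a) / dot (alpha a) (alpha a) <= 0.
    by rewrite pmulr_lle0 ?invr_gt0 // pmulr_rle0 // simple_dot_le0.
  have d0 := dot_drop_coef_le0 a py.
  have kd := mulr_le0 k0 d0.
  split; first exact: addr_ge0.
  rewrite in_cons; have [ry _|ry] := boolP (r \in y).
    by rewrite ltr_wpDr // G1.
  rewrite orbF => /eqP ra; rewrite ltr_wpDl // ltNge.
  rewrite nmulr_rle0; last by rewrite pmulr_llt0 ?invr_gt0 // pmulr_rlt0 // -ra.
  (* If the increment vanished, [q - alpha a] would be orthogonal to [alpha a], and [act (sr a) q]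
     would have coefficient -1 at [alpha a], against [pay]. *)
  apply/negP => d1; have d2 : dot (alpha a) (drop_coef a q) = 0.
    by apply/eqP; rewrite eq_le d0.
  have qE : q = drop_coef a q + alpha a.
    by rewrite /drop_coef co_wact_notin -?ra // co_simple eqxx scale1r subrK.
  move: pay; rewrite wv_cons wactM -/q => /nonnegP/(_ a).
  rewrite qE wactD wact_simple wact_simpleE dotC d2 mulr0 mul0r scale0r subr0.
  by rewrite coB co_drop_coef co_simple eqxx sub0r oppr_ge0 ler10.
- have cw' := coxeter_word_rot cw; have := IH _ E cw' rw sw sr0.
  have : a \notin rcons y r by rewrite E.
  rewrite mem_rcons in_cons negb_or => /andP[ar ay].
  rewrite skew_rot //; first by rewrite coB co_wact_notin // subrr.
  by rewrite co_wact_notin // co_simple (negPf ar).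
Qed.

(** As [s] is initial, restoring the subtracted [alpha s] adds [- dot (alpha s) q], which is
    nonnegative. Strictness comes from [skew_sort_word] if [r] occurs in [y], and otherwise from the
    coefficient 1 of [alpha r] in [q]. *)
Lemma skew_sort_word_initial s c y r : coxeter_word (s :: c) ->
  sort_word (s :: c) (rcons y r) -> reduced sr (rcons y r) ->
  s \notin rcons y r -> dot (alpha s) (alpha r) < 0 ->
  0 < om (s :: c) (act (wv y) (alpha s)) (act (wv y) (alpha r)).
Proof.
move=> cw sw rw sn sr0; have [] := skew_sort_word cw sw rw sn sr0.
have py : pos (act (wv y) (alpha r)).
  by apply/reduced_rcons; [apply: (@reduced_catl _ [:: r])|]; rewrite ?cats1.
move: sn; rewrite mem_rcons in_cons negb_or => /andP[sr' sy].
set p := act _ (alpha s); set q := act _ (alpha r).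
have oE : om (s :: c) p q = om (s :: c) (p - alpha s) q - dot (alpha s) q.
  rewrite -(@skew_initial s c q); first by rewrite -skewDl subrK.
  by rewrite co_wact_notin // co_simple (negPf sr').
rewrite oE.
have qs : drop_coef s q = q.
  by rewrite /drop_coef co_wact_notin // co_simple (negPf sr') scale0r subr0.
have d0 := dot_drop_coef_le0 s py; rewrite -/q qs in d0.
have [ry _ /(_ isT)|ry G0 _] := boolP (r \in y); first by lra.
suff : dot (alpha s) q < 0 by lra.
rewrite dot_co (bigD1 r) //= co_wact_notin // co_simple eqxx mul1r.
apply: le_lt_trans sr0; rewrite gerDl sumr_le0 // => t tr.
have [->|ts] := eqVneq t s.
  by rewrite co_wact_notin // co_simple (negPf sr') mul0r.
rewrite mulr_ge0_le0 ?simple_dot_le0 1?eq_sym //.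
by move/nonnegP: py; apply.
Qed.

(** The statement of [aligned_avoids] below length [m], to serve as induction hypothesis. *)
Definition skip_property m : Prop := forall s c x, (len x < m)%N ->
  coxeter_word (s :: c) -> aligned (s :: c) x -> ~~ ldesc s x -> avoids s x.

Lemma aligned_sort_word m c x : skip_property m -> (len x < m)%N ->
  coxeter_word c -> aligned c x ->
  exists w, [/\ sort_word c w, wv w = x & reduced sr w].
Proof.
move=> skip; move: {2}(len x) (leqnn (len x)) => k.
elim: k c x => [|k IHk] c x.
  rewrite leqn0 => /eqP/len_eq0 -> _ _ _; exists [::]; split=> //.
    exact: sort_nil.
  exact: wv_nil.
move=> xk xm cw al; have [->|x1] := eqVneq x 1%g.
  by exists [::]; split; [exact: sort_nil|exact: wv_nil|].
have [r rx] := ldesc_exists x1.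
move: {2}(index r c) (leqnn (index r c)) => j.
have fire s c' : coxeter_word (s :: c') -> aligned (s :: c') x -> ldesc s x ->
    exists w, [/\ sort_word (s :: c') w, wv w = x & reduced sr w].
  move=> cw' al' sx; have lx := len_ldesc sx.
  have [||||w [sw wx rw]] := IHk (rcons c' s) (sr s * x)%g.
  - lia.
  - lia.
  - exact: coxeter_word_rot.
  - exact: aligned_fire.
  exists (s :: w); split; first exact: sort_fire.
    by rewrite wv_cons wx mulgA sr2 mul1g.
  apply/reducedE; rewrite wv_cons wx mulgA sr2 mul1g lx /=.
  by rewrite (reducedE _).1 // wx.
elim: j c cw al => [|j IHj] [|s c] cw al; try by have := coxeter_mem r cw.
  by rewrite /=; case: eqP cw al => // -> cw al _; apply: fire.
have [sx _|sx] := boolP (ldesc s x); first exact: fire.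
have av := skip _ _ _ xm cw al sx; move=> rj.
have rs : s != r by apply: contraNneq sx => ->.
have [|||w [sw wx rw]] := IHj (rcons c s).
- exact: coxeter_word_rot.
- exact: aligned_skip.
- have := coxeter_mem r cw; rewrite in_cons eq_sym (negPf rs) /= => rc.
  by move: rj; rewrite /= (negPf rs) ltnS -cats1 index_cat rc.
exists w; split=> //; apply: sort_skip => //.
by apply: avoids_notin => //; rewrite wx.
Qed.

(** Removing the last letter [r] of [w] changes the image of [alpha s] by a nonnegative multiple of
    the image of [alpha r]. If the multiple is not zero, the form is positive on the two images, and
    alignment hands the inversion down. *)
Lemma aligned_descend s c x w : coxeter_word (s :: c) -> aligned (s :: c) x ->
  sort_word (s :: c) w -> reduced sr w -> s \notin w ->
  ~~ pos (act x^-1%g (act (wv w) (alpha s))) -> ldesc s x.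
Proof.
move=> cw al; elim/last_ind: w => [|w r IH] sw rw sn.
  by rewrite wv_nil wact1.
have rw' : reduced sr w by apply: (@reduced_catl _ [:: r]); rewrite cats1.
have sw' : sort_word (s :: c) w by apply: (@sort_word_catl _ _ [:: r]);
  rewrite cats1.
have /andP[sr' sn'] : (s != r) && (s \notin w) by rewrite -negb_or -in_cons -mem_rcons.
have pr : pos (act (wv w) (alpha r)) by apply/reduced_rcons.
have pb : pos (act (wv w) (alpha s)) by apply: avoids_simple; exists w.
move=> H; apply: IH => //; move: H.
have rr := dot_gt0 (simple_neq0 r).
have [d0|d0] := eqVneq (dot (alpha s) (alpha r)) 0.
  by rewrite wv_rcons wactM wact_simpleE d0 mulr0 mul0r scale0r subr0.
have {}d0 : dot (alpha s) (alpha r) < 0 by rewrite lt_neqAle d0 simple_dot_le0.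
set k := - (2 * dot (alpha s) (alpha r) / dot (alpha r) (alpha r)).
have k0 : 0 < k.
  by rewrite oppr_gt0 pmulr_llt0 ?invr_gt0 // pmulr_rlt0.
have E : act (wv (rcons w r)) (alpha s) =
    1 *: act (wv w) (alpha s) + k *: act (wv w) (alpha r).
  by rewrite wv_rcons wactM [act (sr r) _]wact_simpleE wactB wactZ scale1r scaleNr.
rewrite E; apply: al => //.
- exact/root_wact/simple_root.
- exact/root_wact/simple_root.
- by rewrite -E; apply/root_wact/simple_root.
- exact: skew_sort_word_initial.
Qed.

(* Write x = y z with y the component of x in the parabolic subgroup without s.
   If z is not 1, then y(alpha_s) is an inversion of x; as y is aligned and
   shorter, it has a sort word, along which [aligned_descend] brings this
   inversion down to alpha_s. *)
Lemma skip_propertyS m : skip_property m -> skip_property m.+1.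
Proof.
move=> skip s c x xm cw al sx.
have [y [z [xE sy zJ lx]]] := parabolic_decomp s x.
have [z1|z1] := eqVneq z 1%g; first by rewrite xE z1 mulg1.
exfalso; move/negP: sx; apply.
have sz : ldesc s z.
  have [r rz] := ldesc_exists z1.
  by have [<-//|rs] := eqVneq r s; have := zJ _ rs; rewrite rz.
(* Only [s] can be a left descent of [z], so [z^-1] keeps nonnegative combinations of the other
   simple roots nonnegative. Hence [x] and [y] have the same inversions among the roots without
   [alpha s]. *)
have zpos d : pos d -> co s d = 0 -> pos (act z^-1%g d).
  move=> /nonnegP pd d0; apply/nonnegP => t; rewrite (co_expand d) wact_sum.
  rewrite /co dot_sumr; apply: sumr_ge0 => r _; rewrite wactZ -/(co t _) coZ.
  have [->|rs] := eqVneq r s; first by rewrite -/(co s d) d0 mul0r.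
  rewrite mulr_ge0 //; first exact: pd.
  by have := zJ _ rs; rewrite /ldesc negbK => /nonnegP.
have invJ b : Phi b -> co s b = 0 -> pos (act x^-1%g b) = pos (act y^-1%g b).
  move=> Pb b0; have b0' : co s (act y^-1%g b) = 0 by rewrite co_avoids //;
    apply: avoidsV.
  rewrite xE invMg wactM; have [p|p] := boolP (pos (act y^-1%g b));
    first exact: zpos.
  apply/negbTE; rewrite -root_sign; last by do 2!apply: root_wact.
  rewrite -wactN; apply: zpos; last by rewrite coN b0' oppr0.
  by rewrite root_sign //; apply: root_wact.
have aly : aligned (s :: c) y.
  move=> b g a e Pb Pg pb pg a0 e0 Pd o0 nd.
  have d0 := avoids_inv_co sy Pd nd.
  have [b0 g0] := co_lin_eq0 pb pg a0 e0 d0.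
  rewrite -invJ //; apply: (al _ g a e) => //; rewrite invJ //.
  by rewrite coD !coZ b0 g0 !mulr0 addr0.
have ly : (len y < m)%N.
  have : len z != 0%N by apply: contra_neq z1; apply: len_eq0.
  by move: xm; rewrite lx; lia.
have [w [sw wy rw]] := aligned_sort_word skip ly cw aly.
apply: (aligned_descend cw al sw rw).
  by apply: avoids_notin => //; rewrite wy.
by rewrite wy xE invMg wactM wactK.
Qed.

Lemma aligned_avoids s c x : coxeter_word (s :: c) -> aligned (s :: c) x ->
  ~~ ldesc s x -> avoids s x.
Proof.
have skip m : skip_property m by elim: m => // m; apply: skip_propertyS.
exact: (skip (len x).+1).
Qed.

(** * Sorting words *)

Section SortingWords.
Variables (c : seq S) (s0 : S).
Hypothesis Hc : coxeter_word c.

(** The index is always below [size c], so the default [s0] is never the result of an overrun. *)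
Definition letter (k : nat) : S := nth s0 c (k %% size c).

Lemma size_c_gt0 : (0 < size c)%N.
Proof. by have := coxeter_mem s0 Hc; case: (c). Qed.

Lemma clettersE p : cletters c p = map letter p.
Proof.
elim: p => //= k p <-; rewrite /cletters /=.
have kc : (k %% size c < size c)%N by rewrite ltn_pmod ?size_c_gt0.
have := onthTE c (k %% size c); rewrite kc; case E: (onth _ _) => [s|] // _.
by congr (_ :: _); rewrite /letter; symmetry; apply: onth_nth.
Qed.

Lemma letterD k : letter (k + size c) = letter k.
Proof. by rewrite /letter modnDr. Qed.

(** The rotation of [c] that starts at position [k] of ccc...; alignment after [k] steps refers to
    it. *)
Definition window k : seq S := mkseq (fun i => letter (k + i)) (size c).

Lemma windowE k : exists d, window k = letter k :: d /\
  window k.+1 = rcons d (letter k).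
Proof.
rewrite /window; have := letterD k; have := size_c_gt0.
case: (size c) => // m _ E; exists (mkseq (fun i => letter (k.+1 + i)) m).
split; last by rewrite mkseqS addSnnS E.
rewrite /mkseq /= addn0 -{1}[1%N]addn0 iotaDl -map_comp.
by congr (_ :: _); apply: eq_map => i /=; rewrite addnA addn1.
Qed.

Lemma window_coxeter k : coxeter_word (window k).
Proof.
elim: k => [|k IH]; last first.
  have [d [E1 E2]] := windowE k; rewrite E2.
  by apply: coxeter_word_rot; rewrite -E1.
have -> // : window 0 = c.
rewrite /window -{2}(mkseq_nth s0 c); apply/eq_in_map => i.
by rewrite mem_iota /letter => ic; rewrite add0n modn_small.
Qed.

Lemma window_inj k i j : (i < size c)%N -> (j < size c)%N ->
  letter (k + i) = letter (k + j) -> i = j.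
Proof.
have := coxeter_uniq (window_coxeter k) => /mkseq_uniqP inj ic jc.
exact: inj.
Qed.

Lemma next_occurrence k t : exists m,
  [/\ (m < size c)%N, letter (k + m) = t
    & forall i, (i < m)%N -> letter (k + i) != t].
Proof.
have /mapP[m] := coxeter_mem t (window_coxeter k).
rewrite mem_iota => mc tE; exists m; split=> // i im.
apply/eqP => E; rewrite tE in E.
by move: (im); rewrite (window_inj (ltn_trans im mc) mc E) ltnn.
Qed.

(** Where a smaller reduced subword first departs from [p], it uses a position that [p] skips. The
    letter there would be a left descent of what [p] still has to spell. *)
Lemma first_subword_greedy w p : reduced_subword sr c w p ->
  (forall i, i \notin p ->
    ~~ ldesc (letter i) (wv (map letter [seq j <- p | (i < j)%N]))) ->
  first_reduced_subword sr c w p.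
Proof.
move=> rp greedy; split=> // q [sq wq rq].
case: rp => sp wp rp'; rewrite !clettersE in wp rp' wq rq.
(* [p1] is the part already found common to both; [r] and [q'] are the remainders, which spell the
   same element. *)
suff H (r p1 q' : seq nat) : sorted ltn (p1 ++ q') ->
    reduced sr (map letter r) -> reduced sr (map letter q') ->
    wv (map letter r) = wv (map letter q') -> p = p1 ++ r ->
    ((r : Order.SeqLexiOrder.Exports.seqlexi nat) <= q')%O.
  by apply: (H _ [::]) => //; rewrite wp wq.
elim: r p1 q' => {q sq wq rq} [|j r IH] p1 q sq rr rq E pE;
  first by rewrite Order.SeqLexiOrder.Exports.lexi0s.
case: q sq rq E => [|i q] sq rq E.
  move: rr => /reducedE; rewrite E wv_nil len1 //.
rewrite Order.SeqLexiOrder.Exports.lexi_cons leEnat.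
have ji : (j <= i)%N.
  rewrite leqNgt; apply/negP => ij.
  have p1i : {in p1, forall a, (a < i)%N}.
    move: sq; rewrite (sorted_pairwise ltn_trans) pairwise_cat =>
      /and3P[/allrelP H _ _] a ap.
    by apply: H => //; rewrite inE eqxx.
  have jr : {in j :: r, forall a, (j <= a)%N}.
    move: sp; rewrite pE (sorted_pairwise ltn_trans) pairwise_cat /=.
    move=> /and3P[_ _ /andP[/allP H _]] a; rewrite inE => /orP[/eqP->//|/H].
    exact: ltnW.
  have ip : i \notin p.
    rewrite pE mem_cat negb_or; apply/andP; split; apply/negP.
      by move/p1i; rewrite ltnn.
    by move/jr; rewrite leqNgt ij.
  have fE : [seq a <- p | (i < a)%N] = j :: r.
    rewrite pE filter_cat (_ : [seq a <- p1 | (i < a)%N] = [::]) ?cat0s.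
      by apply/all_filterP/allP => a /jr; apply: leq_trans.
    apply/eqP; rewrite -(negbK (_ == _)) -has_filter; apply/hasPn => a /p1i.
    by rewrite -leqNgt; apply: ltnW.
  have := greedy i ip; rewrite fE E => /negP; apply.
  by apply: ldesc_cons.
rewrite ji /=; apply/implyP => ij.
have {ij ji} ij : i = j by apply/eqP; rewrite eqn_leq ij.
subst i; apply: (IH (rcons p1 j)).
- by rewrite cat_rcons.
- exact: (@reduced_catr [:: letter j]).
- exact: (@reduced_catr [:: letter j]).
- by move: E; rewrite /= !wv_cons => /mulgI.
- by rewrite cat_rcons.
Qed.

Lemma sorting_positions_first w p : first_reduced_subword sr c w p ->
  sorting_positions sr c w = p.
Proof.
move=> fp; apply: xget_unique => // q fq.
apply: (@le_anti _ (Order.SeqLexiOrder.Exports.seqlexi nat)).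
case: fp fq => rp fp [rq fq]; apply/andP; split; [exact: fq|exact: fp].
Qed.

Lemma csortable_positions w p : sorting_positions sr c w = p ->
  (forall q, q \in p -> (size c <= q)%N -> (q - size c)%N \in p) ->
  csortable sr c w.
Proof.
move=> wp Hp i; apply/fintype.subsetP => s; rewrite !inE wp !clettersE.
case/mapP => q; rewrite mem_filter => /andP[/eqP qi qp] ->.
have cq : (size c <= q)%N.
  by rewrite leqNgt; apply/negP => h; rewrite divn_small in qi.
apply/mapP; exists (q - size c)%N; last by rewrite -{1}(subnK cq) letterD.
by rewrite mem_filter Hp // andbT divnBr // divnn size_c_gt0 qi subn1.
Qed.

(** * Greedy reading of the longest element *)

Variable w0 : gT.
Hypothesis Hw0 : forall b, Phi b -> pos b -> ~~ pos (act w0^-1%g b).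

(* rest k is what remains of w0 after the greedy reading of the first k letters
   of ccc... *)
Fixpoint rest (k : nat) : gT :=
  if k is j.+1 then
    if ldesc (letter j) (rest j) then (sr (letter j) * rest j)%g else rest j
  else w0.

Definition taken k : bool := ldesc (letter k) (rest k).

Definition taken_in i m : seq nat := [seq j <- iota i m | taken j].

Definition prefix_elt k : gT := wv (map letter (taken_in 0 k)).
Notation u := prefix_elt.

Lemma rest_word i m :
  rest i = (wv (map letter (taken_in i m)) * rest (i + m))%g /\
  len (rest i) = (size (taken_in i m) + len (rest (i + m)))%N.
Proof.
elim: m i => [|m IH] i; first by rewrite addn0 wv_nil mul1g.
have [E1 E2] := IH i.+1; rewrite addnS -addSn /taken_in /= -/(taken_in i.+1 m).
case: ifP => ti /=.
  have rS : rest i.+1 = (sr (letter i) * rest i)%g by rewrite /= -/(taken i) ti.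
  rewrite wv_cons -mulgA -E1 rS mulgA sr2 mul1g (len_ldesc ti) -rS E2.
  by split.
have rS : rest i.+1 = rest i by rewrite /= -/(taken i) ti.
by rewrite -rS.
Qed.

Lemma reduced_taken i m r : reduced sr r -> wv r = rest (i + m) ->
  reduced sr (map letter (taken_in i m) ++ r).
Proof.
move=> /reducedE rr rE; apply/reducedE; have [E1 E2] := rest_word i m.
by rewrite size_cat size_map wv_cat rr rE -E1 E2.
Qed.

Lemma prefix_eltM k : (u k * rest k)%g = w0.
Proof. by have [E _] := rest_word 0 k; rewrite -E. Qed.

Lemma taken_inS k : taken_in 0 k.+1 =
  if taken k then rcons (taken_in 0 k) k else taken_in 0 k.
Proof.
rewrite /taken_in -addn1 iotaD filter_cat add0n /=.
by case: ifP; rewrite ?cats1 ?cats0.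
Qed.

Lemma prefix_eltS k : taken k -> u k.+1 = (u k * sr (letter k))%g.
Proof. by rewrite /u taken_inS => ->; rewrite map_rcons wv_rcons. Qed.

Lemma prefix_eltS_skip k : ~~ taken k -> u k.+1 = u k.
Proof. by rewrite /u taken_inS => /negPf ->. Qed.

(** [w0] is the product of [u k] and [rest k], and its inverse changes the sign of every root. *)
Lemma ldesc_rest t k : ldesc t (rest k) = pos (act (u k) (alpha t)).
Proof.
have Pt := root_wact (u k) (simple_root t).
have E : act (rest k)^-1%g (alpha t) = act w0^-1%g (act (u k) (alpha t)).
  by rewrite -(prefix_eltM k) invMg wactM wactK.
rewrite /ldesc E; have [p|p] := boolP (pos (act (u k) (alpha t))).
  by rewrite Hw0.
apply/negbTE; rewrite negbK -[act (u k) _]opprK wactN root_sign.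
  by rewrite Hw0 ?root_sign //; apply: rootN.
by apply: root_wact; apply: rootN.
Qed.

(** [w0] is aligned because all positive roots are its inversions; each step then takes or skips a
    letter and rotates the word. *)
Lemma aligned_rest k : aligned (window k) (rest k).
Proof.
elim: k => [|k IH]; first by move=> b g a e Pb _ pb *; apply: Hw0.
have [d [E1 E2]] := windowE k; rewrite E2; rewrite E1 in IH.
have cw : coxeter_word (letter k :: d) by rewrite -E1; apply: window_coxeter.
rewrite /=; case: ifP => tk; first exact: aligned_fire.
by apply: aligned_skip => //; apply: (aligned_avoids cw IH); rewrite tk.
Qed.

(** Alignment puts [rest k] in the parabolic subgroup. The letters taken later are left descents of
    its elements, so they differ from the skipped one. *)
Lemma skip_avoids k k' : ~~ taken k -> (k <= k')%N ->
  avoids (letter k) (rest k').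
Proof.
move=> tk /subnKC <-; elim: (k' - k)%N => [|m IH].
  have [d [E1 _]] := windowE k; have al := @aligned_rest k.
  have cw := window_coxeter k.
  by rewrite addn0; rewrite E1 in al cw; apply: (aligned_avoids cw al).
rewrite addnS /=; case: ifP => // td; apply: avoidsM => //; apply: avoids_sr.
by apply: contraL td => /eqP <-; apply: avoids_ldesc.
Qed.

Lemma skip_skip k k' : ~~ taken k -> (k <= k')%N -> letter k' = letter k ->
  ~~ taken k'.
Proof.
by move=> tk kk E; rewrite /taken E; apply/avoids_ldesc/skip_avoids.
Qed.

Lemma mem_taken i m j : (j \in taken_in i m) = (i <= j < i + m)%N && taken j.
Proof. by rewrite mem_filter mem_iota andbC. Qed.

Lemma sorted_taken i m : sorted ltn (taken_in i m).
Proof. by apply: (sorted_filter ltn_trans); apply: iota_ltn_sorted. Qed.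

Lemma taken_filter i k : (i < k)%N ->
  [seq j <- taken_in 0 k | (i < j)%N] = taken_in i.+1 (k - i.+1).
Proof.
move=> ik; rewrite /taken_in -{1}(subnKC ik) iotaD !filter_cat add0n.
rewrite (_ : [seq _ <- [seq j <- iota 0 _ | _] | _] = [::]) ?cat0s.
  apply/all_filterP/allP => j; rewrite mem_filter mem_iota.
  by case/and3P.
apply/eqP; rewrite -(negbK (_ == _)) -has_filter; apply/hasPn => j.
by rewrite mem_filter mem_iota -leqNgt => /and3P[].
Qed.

Lemma taken_filter_ge i k : (k <= i)%N ->
  [seq j <- taken_in 0 k | (i < j)%N] = [::].
Proof.
move=> ki; apply/eqP; rewrite -(negbK (_ == _)) -has_filter; apply/hasPn => j.
rewrite mem_taken -leqNgt => /andP[/andP[_ jk] _].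
by apply: ltnW; apply: leq_trans ki.
Qed.

Lemma skip_greedy k r i : reduced sr r -> wv r = rest k -> (i < k)%N ->
  ~~ taken i ->
  ~~ ldesc (letter i) (wv (map letter (taken_in i.+1 (k - i.+1)) ++ r)).
Proof.
move=> rr rE ik ti; have [E _] := rest_word i.+1 (k - i.+1).
rewrite subnKC // in E; rewrite wv_cat rE -E.
by rewrite /= -/(taken i) (negPf ti).
Qed.

(** A skipped letter is not a left descent of the whole remainder of [w0], let alone of the initial
    factor of it read up to step [k]. *)
Lemma sorting_positions_prefix k : sorting_positions sr c (u k) = taken_in 0 k.
Proof.
have [r [rE rl]] := len_word (rest k).
have rr : reduced sr r by apply/reducedE; rewrite rE.
apply: sorting_positions_first; apply: first_subword_greedy.
  split; rewrite ?clettersE //; first exact: sorted_taken.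
  exact: (reduced_catl (@reduced_taken 0 k r rr rE)).
move=> i ip; have [ik|ki] := ltnP i k; last first.
  by rewrite taken_filter_ge // wv_nil; apply/avoids_ldesc/avoids1.
have ti : ~~ taken i by move: ip; rewrite mem_taken ik.
rewrite taken_filter //; have := skip_greedy rr rE ik ti.
apply: contra; apply: ldesc_cat; apply: reduced_taken => //.
by rewrite subnKC.
Qed.

Lemma sorting_word_prefix k :
  sorting_word sr c (u k) = map letter (taken_in 0 k).
Proof. by rewrite /sorting_word sorting_positions_prefix clettersE. Qed.

Lemma csortable_prefix k : csortable sr c (u k).
Proof.
apply: (csortable_positions (sorting_positions_prefix k)) => q.
rewrite !mem_taken /= !add0n => /andP[qk tq] cq.
rewrite (leq_ltn_trans (leq_subr _ _) qk) /=; apply: contraT => tk.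
have := skip_skip tk (leq_subr _ _);
  rewrite -{1}(subnK cq) letterD => /(_ erefl).
by rewrite tq.
Qed.

(** The sorting word of this cover is that of [u k] followed by the next [t] in ccc..., at position
    [k + m]. The result yields that [u k] is a singleton. *)
Lemma csortable_prefix_cover k t : pos (act (u k) (alpha t)) ->
  csortable sr c (u k * sr t)%g.
Proof.
rewrite -ldesc_rest => tk; have [m [mc mt mmin]] := next_occurrence k t.
have [r [rE rl]] := len_word (sr t * rest k)%g.
have trE : wv (t :: r) = rest k by rewrite wv_cons rE mulgA sr2 mul1g.
have tr : reduced sr (t :: r).
  by apply/reducedE; rewrite trE (len_ldesc tk) /= rl.
have sE : sorting_positions sr c (u k * sr t)%g = rcons (taken_in 0 k) (k + m)%N.
  apply: sorting_positions_first; apply: first_subword_greedy.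
    split; rewrite ?clettersE ?map_rcons ?mt.
    - rewrite (sorted_pairwise ltn_trans) pairwise_rcons.
      rewrite -(sorted_pairwise ltn_trans) sorted_taken andbT.
      by apply/allP => j; rewrite mem_taken => /andP[/andP[_ jk] _];
        apply: ltn_addr.
    - by rewrite wv_rcons.
    - by apply: (@reduced_catl _ r); rewrite cat_rcons;
      apply: (@reduced_taken 0 k (t :: r) tr trE).
  move=> i; rewrite mem_rcons in_cons negb_or filter_rcons => /andP[im ip].
  have [ik|ki] := ltnP i k.
    have ti : ~~ taken i by move: ip; rewrite mem_taken ik.
    rewrite ltn_addr // taken_filter // map_rcons mt.
    have := skip_greedy tr trE ik ti; rewrite -cat_rcons.
    apply: contra; apply: ldesc_cat; rewrite cat_rcons;
      apply: reduced_taken => //.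
    by rewrite subnKC.
  rewrite taken_filter_ge //; case: ifP => ikm /=; last first.
    by rewrite wv_nil; apply/avoids_ldesc/avoids1.
  rewrite mt wv_seq1; apply/avoids_ldesc/avoids_sr.
  by rewrite -(subnKC ki) mmin //; lia.
apply: (csortable_positions sE) => q.
rewrite !mem_rcons !in_cons !mem_taken /= => /orP[/eqP-> cq|/andP[qk tq] cq].
  apply/orP; right; apply/andP; split; first by lia.
  (* A skip one period before [k + m] would keep [t] out of [rest k], of which [t] is a left
     descent. *)
  apply: contraT => tm; have /(skip_avoids tm) : (k + m - size c <= k)%N by lia.
  by rewrite -letterD subnK // mt => /avoids_ldesc; rewrite tk.
apply/orP; right; apply/andP; split; first by lia.
apply: contraT => tk'; have := skip_skip tk' (leq_subr _ _).
by rewrite -{1}(subnK cq) letterD => /(_ erefl); rewrite tq.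
Qed.

(** Reading on to the next occurrence of a left descent of [rest k] takes at least one letter, so
    the remainder keeps getting shorter. *)
Lemma prefix_elt_longest : exists K, u K = w0.
Proof.
suff [K rK] : exists K, rest K = 1%g.
  by exists K; rewrite -(prefix_eltM K) rK mulg1.
suff H m k : (len (rest k) <= m)%N -> exists K, rest K = 1%g.
  exact: (H _ 0 (leqnn _)).
elim: m k => [|m IH] k; first by rewrite leqn0 => /eqP/len_eq0; exists k.
move=> lk; have [|r1] := eqVneq (rest k) 1%g; first by exists k.
have [t tk] := ldesc_exists r1; have [j [jc jt _]] := next_occurrence k t.
apply: (IH (k + j.+1)%N); have [E1 E2] := rest_word k j.+1.
have [E|E] := eqVneq (size (taken_in k j.+1)) 0%N; last by lia.
have {}E := size0nil E; exfalso.
have : (k + j)%N \in taken_in k j.+1.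
  rewrite mem_taken /taken jt; have [F _] := rest_word k j.
  have -> : rest (k + j) = rest k.
    move: E; rewrite F /taken_in -(addn1 j) iotaD filter_cat => /nilP.
    by rewrite cat_nilp => /andP[/nilP-> _]; rewrite wv_nil mul1g.
  by rewrite tk; lia.
by rewrite E.
Qed.

(** At the first step where [b] becomes an inversion of the prefix, it is the single inversion which
    that step adds. *)
Lemma inversion_prefix b : Phi b -> pos b ->
  exists2 k, taken k & act (u k) (alpha (letter k)) = b.
Proof.
move=> Pb pb.
have ex : exists k, ~~ pos (act (u k)^-1%g b).
  by have [K KE] := prefix_elt_longest; exists K; rewrite KE; apply: Hw0.
case: (ex_minnP ex) => [[|k]]; first by rewrite /u wv_nil invg1 wact1 pb.
move=> nk /(_ k); rewrite ltnn;
  have [pk _|_ /(_ isT)//] := boolP (pos (act (u k)^-1%g b)).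
exists k; first by apply: contraNT nk => /prefix_eltS_skip ->.
move: nk; have [tk|/prefix_eltS_skip->] := boolP (taken k); last by rewrite pk.
rewrite prefix_eltS // invMg srV wactM => nk.
apply: (canLR (wactVK _)); apply/esym/eqP; apply: contraNT nk => E.
by rewrite nonneg_wact_simple //; apply: root_wact.
Qed.

(** Were the first [s] skipped, [w0] would lie in the parabolic subgroup without [s], although
    [alpha s] is its inversion. *)
Lemma first_taken s : exists2 k, taken k &
  letter k = s /\ s \notin map letter (taken_in 0 k).
Proof.
have [k [kc ks kmin]] := next_occurrence 0 s; rewrite add0n in ks.
have sk : s \notin map letter (taken_in 0 k).
  apply/mapP => -[j]; rewrite mem_taken => /andP[/andP[_ jk] _] sj.
  by have := kmin _ jk; rewrite -sj eqxx.
exists k => //; apply: contraT => tk.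
have : avoids s w0.
  rewrite -(prefix_eltM k); apply: avoidsM;
    first by exists (map letter (taken_in 0 k)).
  by rewrite -ks; apply: skip_avoids.
move=> /avoidsV/avoids_simple; rewrite (negPf (Hw0 _ _)) ?nonneg_simple //.
exact: simple_root.
Qed.

(** * Weak order and c-singletons *)

Lemma weak_le_len x w : weak_le sr x w -> (len x <= len w)%N.
Proof.
move=> [a [b [rab <- <-]]]; have /reducedE <- := reduced_catl rab.
by have /reducedE <- := rab; rewrite size_cat leq_addr.
Qed.

Lemma weak_le_len_eq x w : weak_le sr x w -> (len w <= len x)%N -> w = x.
Proof.
move=> [a [b [rab <- <-]]]; have /reducedE <- := reduced_catl rab.
have /reducedE <- := rab; rewrite size_cat -{2}(addn0 (size a)) leq_add2l.
by rewrite leqn0 => /nilP ->; rewrite cats0.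
Qed.

Lemma weak_le_refl x : weak_le sr x x.
Proof.
have [a [aE al]] := len_word x; exists a, [::]; rewrite cats0 aE.
by split=> //; apply/reducedE; rewrite aE.
Qed.

Lemma pidown_csortable w : csortable sr c w -> pidown sr c w = w.
Proof.
move=> cw; apply: xget_unique => [|x [_ xw /(_ w cw (weak_le_refl w) xw) //]].
split=> //; first exact: weak_le_refl.
by move=> y _ yw wy; apply: (weak_le_len_eq wy); apply: weak_le_len.
Qed.

Lemma pidown_maximal w : maximal_sortable_below sr c w (pidown sr c w).
Proof.
apply: xgetPex.
pose P g := `[< csortable sr c g /\ weak_le sr g w >].
have P1 : P 1%g.
  apply/asboolP; split.
    have -> : 1%g = u 0 by rewrite /u wv_nil.
    exact: csortable_prefix.
  have [b [bE bl]] := len_word w; exists [::], b; rewrite /= wv_nil bE.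
  by split=> //; apply/reducedE; rewrite bE.
case: (arg_maxnP (fun g => len g) P1) => x /asboolP[cx xw] xmax.
exists x; split=> // y cy yw xy; apply: (weak_le_len_eq xy).
by apply: xmax; apply/asboolP.
Qed.

(** A larger element of the fibre would lie above a cover of [u k]. That cover is sortable, against
    the maximality of [u k]. *)
Lemma csingleton_prefix k : csingleton sr c (u k).
Proof.
apply/seteqP; split=> [w /= wE|_ ->];
  last exact/pidown_csortable/csortable_prefix.
have [_] := pidown_maximal w; rewrite wE => -[a [b [rab aE <-]]].
case: b rab => [|t b] rab max; first by rewrite cats0.
exfalso; rewrite -cat_rcons in rab max.
have ra : reduced sr a by apply: (@reduced_catl _ (t :: b)); rewrite -cat_rcons.
have rat := reduced_catl rab.
have pt : pos (act (u k) (alpha t)) by rewrite -aE; apply/reduced_rcons.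
have E := max (u k * sr t)%g (csortable_prefix_cover pt).
have := len_asc pt; rewrite E; first by lia.
- by exists (rcons a t), b; rewrite wv_rcons aE.
- by exists a, [:: t]; rewrite cats1 wv_rcons aE.
Qed.

Lemma Lr_prefixS k : taken k ->
  Lr rG sr alpha c (letter k) (u k.+1) = act (u k) (alpha (letter k)).
Proof.
move=> tk;
  rewrite /Lr sorting_word_prefix taken_inS tk map_rcons mem_rcons inE eqxx /=.
by rewrite rev_rcons /= eqxx size_rcons subn1 -cats1 take_size_cat.
Qed.

(** The appended letter is not [t], so the part before the rightmost [t] stays the same. *)
Lemma Lr_prefixS_neq k t : taken k -> t != letter k ->
  Lr rG sr alpha c t (u k.+1) = Lr rG sr alpha c t (u k).
Proof.
move=> tk ts;
  rewrite /Lr !sorting_word_prefix taken_inS tk map_rcons mem_rcons inE.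
rewrite (negPf ts) /= rev_rcons /= eq_sym (negPf ts) size_rcons subSS -cats1.
by rewrite takel_cat // leq_subr.
Qed.
End SortingWords.

(** * Chambers and their rays *)

Lemma weight_expand x : x = \sum_s dot x (alpha s) *: v s.
Proof.
apply/eqP; rewrite -subr_eq0 -dot_eq0; set d := x - _.
have d0 t : dot d (alpha t) = 0.
  rewrite /d dotBl dot_suml; under eq_bigr => s _ do rewrite dotZl Hv eq_sym.
  by rewrite sum_delta subrr.
by rewrite (dot_co d d) big1 // => t _; rewrite d0 mulr0.
Qed.

Lemma weight_neq0 s : v s != 0.
Proof.
apply/eqP => v0; have := Hv s s; rewrite v0 dot0l eqxx => /esym/eqP.
by rewrite oner_eq0.
Qed.

Lemma wact_neq0 g x : x != 0 -> act g x != 0.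
Proof. by apply: contra_neq => E; rewrite -(wactK g x) E wact0. Qed.

Lemma image_halfline g x : act g @` halfline x = halfline (act g x).
Proof.
apply/seteqP; split=> [_ [_ [k k0 <-] <-]|_ [k k0 <-]].
  by exists k; rewrite ?wactZ.
by exists (k *: x); [exists k|rewrite wactZ].
Qed.

Lemma halfline_eq (x y : V) : halfline x = halfline y ->
  exists2 k : R, 0 <= k & x = k *: y.
Proof.
move=> E; have : halfline x x by exists 1; rewrite ?scale1r //= ler01.
by rewrite E => -[k k0 <-]; exists k.
Qed.

Lemma halfline_scale k (x : V) : k != 0 -> halfline x (k *: x) -> x != 0 ->
  halfline (k *: x) = halfline x.
Proof.
move=> k0 [k' /= k'0 /eqP]; rewrite -subr_eq0 -scalerBl scaler_eq0 subr_eq0.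
move=> /orP[/eqP kE|->] // _; rewrite kE in k'0.
apply/seteqP; split=> [_ [j /= j0 <-]|_ [j /= j0 <-]].
  by exists (j * k); rewrite ?scalerA //= mulr_ge0.
by exists (j / k); rewrite ?scalerA ?divfK //= divr_ge0.
Qed.

Lemma weight_chamber s : fundamental_chamber alpha (v s).
Proof. by move=> t; rewrite Hv ler0n. Qed.

Lemma extremal_rays_chamber g :
  extremal_rays (act g @` fundamental_chamber alpha) =
  [set halfline (act g (v s)) | s in [set: S]].
Proof.
apply/seteqP; split=> [F [[l [l0 FE]] [z z0 Fz]]|_ [s _ <-]]; last first.
  split; last by exists (act g (v s)) => //; apply/wact_neq0/weight_neq0.
  (* On the chamber this functional sums the coordinates other than the one at [s], all nonnegative;
     it vanishes there exactly on the ray of [v s]. *)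
  exists (act g (\sum_(t | t != s) alpha t)); split=> [_ [x Dx <-]|].
    rewrite dot_wact dot_suml; apply: sumr_ge0 => t _.
    by rewrite dotC; apply: Dx.
  apply/seteqP; split=> [_ [k /= k0 <-]|_ [[x Dx <-]] /=].
    split; first by exists (k *: v s); rewrite ?wactZ // => t;
      rewrite dotZl mulr_ge0 // weight_chamber.
    rewrite /= -wactZ dot_wact dotZr dot_suml big1 ?mulr0 // => t ts.
    by rewrite dotC Hv eq_sym (negPf ts).
  rewrite dot_wact dot_suml => /psumr_eq0P => x0.
  exists (dot x (alpha s)); first exact: Dx.
  rewrite -wactZ; congr (act g _); rewrite [RHS]weight_expand (bigD1 s) //=.
  rewrite big1 ?addr0 // => t ts; rewrite dotC x0 ?scale0r // => r _.
  by rewrite dotC; apply: Dx.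
have lv s : 0 <= dot l (act g (v s)).
  by apply: l0; exists (v s) => //; apply: weight_chamber.
have : F z by rewrite Fz; exists 1; rewrite ?scale1r //= ler01.
rewrite FE => -[[x Dx xz] /= lz].
have x0 : x != 0 by apply: contra_neq z0 => x0; rewrite -xz x0 wact0.
(* Any [s] with a nonzero coordinate will do: [l] is nonnegative on each weight and vanishes on
   their combination [x], hence on [v s]. *)
have [s xs] : exists s, dot x (alpha s) != 0.
  apply/existsP; apply: contraNT x0 => /existsPn x0.
  rewrite (weight_expand x) big1 // => s _.
  by have := x0 s; rewrite negbK => /eqP ->; rewrite scale0r.
have ls : dot l (act g (v s)) = 0.
  move: lz; rewrite -xz (weight_expand x) wact_sum dot_sumr => /psumr_eq0P H.
  have : dot l (act g (dot x (alpha s) *: v s)) = 0.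
    by apply: H => // t _; rewrite wactZ dotZr mulr_ge0 //; apply: Dx.
  by rewrite wactZ dotZr => /eqP; rewrite mulf_eq0 (negPf xs) /= => /eqP.
exists s => //; have : F (act g (v s)).
  by rewrite FE; split=> //; exists (v s) => //; apply: weight_chamber.
rewrite Fz => /[dup] Fv [k /= k0 kE]; rewrite -kE in Fv *; rewrite -FE Fz;
  apply: halfline_scale => //.
by apply/eqP => kk; have := wact_neq0 g (weight_neq0 s);
  rewrite -kE kk scale0r eqxx.
Qed.

(** If [s] is a right descent of [g], then [dot x (alpha s)] is both nonnegative and nonpositive. So
    [s] fixes [x], and [g] can be shortened to [g s]. *)
Lemma chamber_fundamental g x y : fundamental_chamber alpha x ->
  fundamental_chamber alpha y -> act g x = y -> x = y.
Proof.
move=> Dx Dy; move: {2}(len g) (leqnn (len g)) => m.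
elim: m g => [|m IH] g; first by rewrite leqn0 => /eqP/len_eq0 ->;
  rewrite wact1.
move=> lg gx; have [g1|g1] := eqVneq g 1%g; first by rewrite -gx g1 wact1.
have gV1 : g^-1%g != 1%g by rewrite eq_invg1.
have [s sg] := ldesc_exists gV1; rewrite /ldesc invgK in sg.
apply: (IH (g * sr s)%g); first by have := len_desc sg; lia.
suff xs : dot x (alpha s) = 0.
  by rewrite wactM wact_simpleE xs mulr0 mul0r scale0r subr0.
apply/eqP; rewrite eq_le Dx andbT -(dot_wact g) gx dot_co sumr_le0 // => t _.
apply: mulr_le0_ge0; last exact: Dy.
move: sg; rewrite -root_sign; last exact/root_wact/simple_root.
by move/nonnegP/(_ t); rewrite coN oppr_ge0.
Qed.

Lemma ray_type_unique g h s t :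
  halfline (act g (v s)) = halfline (act h (v t)) -> s = t.
Proof.
move=> /halfline_eq[k k0 E].
have {}E : act (h^-1 * g)%g (v s) = k *: v t by rewrite wactM E wactZ wactK.
have Dk : fundamental_chamber alpha (k *: v t).
  by move=> r; rewrite dotZl mulr_ge0 // weight_chamber.
have := chamber_fundamental (weight_chamber s) Dk E => /(congr1 (fun x => dot x (alpha s))).
rewrite dotZl !Hv eqxx; case: eqVneq => // _ /eqP.
by rewrite mulr0 oner_eq0.
Qed.

(** * Matching rays with their labels *)

Section Bijection.
Variables (c : seq S) (f : set V -> V).
Hypothesis Hf : cambrian_bijection rG sr alpha Phi c f.

Lemma cambrian_cone_singleton w : csingleton sr c w ->
  cambrian_cone rG sr alpha c w = act w @` fundamental_chamber alpha.
Proof.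
by rewrite /cambrian_cone /csingleton /preimage => ->;
  rewrite bigcup_set1.
Qed.

Lemma singleton_ray w s : csortable sr c w -> csingleton sr c w ->
  cambrian_rays rG sr alpha c (halfline (act w (v s))).
Proof.
move=> cw sw; have : extremal_rays (act w @` fundamental_chamber alpha)
    (halfline (act w (v s))) by rewrite extremal_rays_chamber; exists s.
by rewrite -cambrian_cone_singleton // => -[fw rw]; split=> //; exists w.
Qed.

Lemma singleton_cluster w : csortable sr c w -> csingleton sr c w ->
  [set f (halfline (act w (v s))) | s in [set: S]] = cluster rG sr alpha c w.
Proof.
move=> cw sw; have [_ /(_ w cw) <-] := Hf.
by rewrite cambrian_cone_singleton // extremal_rays_chamber image_comp.
Qed.

(* The clusters of two singletons that differ by one exchange share all other
   elements, so injectivity of f identifies the image of the exchanged ray. *)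
Lemma exchange_label w w' s :
  csortable sr c w -> csingleton sr c w ->
  csortable sr c w' -> csingleton sr c w' ->
  (forall t, t != s -> Lr rG sr alpha c t w = Lr rG sr alpha c t w') ->
  halfline (act w (v s)) <> halfline (act w' (v s)) ->
  f (halfline (act w (v s))) = Lr rG sr alpha c s w.
Proof.
move=> cw sw cw' sw' E neq;
  have : cluster rG sr alpha c w (f (halfline (act w (v s)))).
  by rewrite -singleton_cluster //; exists s.
move=> [t _]; have [->//|ts] := eqVneq t s; rewrite E // => tE.
have : cluster rG sr alpha c w' (f (halfline (act w (v s)))) by exists t.
rewrite -singleton_cluster // => -[r _ rE].
have [[_ inj _] _] := Hf.
have rayE : halfline (act w' (v r)) = halfline (act w (v s)).
  by apply: inj rE; rewrite inE; apply: singleton_ray.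
by case: neq; rewrite -rayE (ray_type_unique rayE).
Qed.

Lemma ray_exchange_neq g s :
  halfline (act g (v s)) <> halfline (act (g * sr s)%g (v s)).
Proof.
move=> /halfline_eq[k k0]; rewrite wactM -wactZ => /(can_inj (wactK g)).
move=> /(congr1 (fun x => dot x (alpha s)));
  rewrite dotZl dot_wactl srV wact_simple.
rewrite dotNr Hv eqxx mulrN1 => E.
by move: k0; rewrite -oppr_le0 -E lern0.
Qed.

Hypothesis Hc : coxeter_word c.

Lemma ray_of_singleton rho : cambrian_rays rG sr alpha c rho ->
  exists s w, [/\ csingleton sr c w, rho = halfline (act w (v s))
    & f (halfline (act w (v s))) = Lr rG sr alpha c s w].
Proof.
move=> Hrho; have [[fun_ inj _] _] := Hf; have [w0 Hw0] := longest_exists.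
have [s0 _] : exists s0 : S, True.
  have [_ [x x0 _]] := Hrho; apply: contrapT => S0; case/eqP: x0.
  by rewrite (co_expand x) big1 // => s _; case: S0; exists s.
pose u := prefix_elt c s0 w0.
have cs k : csortable sr c (u k) by apply: csortable_prefix.
have sg k : csingleton sr c (u k) by apply: csingleton_prefix.
have label k : taken c s0 w0 k ->
    f (halfline (act (u k) (v (letter c s0 k)))) = Lr rG sr alpha c (letter c s0 k) (u k) /\
    f (halfline (act (u k.+1) (v (letter c s0 k)))) =
      Lr rG sr alpha c (letter c s0 k) (u k.+1).
  move=> tk;
    have uS : u k.+1 = (u k * sr (letter c s0 k))%g by apply: prefix_eltS.
  have neq := @ray_exchange_neq (u k) (letter c s0 k); rewrite -uS in neq.
  split; [apply: (@exchange_label _ (u k.+1))|apply: (@exchange_label _ (u k))] => //.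
  - by move=> t ts; rewrite Lr_prefixS_neq.
  - by move=> t ts; rewrite Lr_prefixS_neq.
  - exact: nesym.
(* By injectivity of [f], a ray whose label equals that of [rho] is [rho]. *)
have found s k : f (halfline (act (u k) (v s))) = Lr rG sr alpha c s (u k) ->
    f rho = Lr rG sr alpha c s (u k) -> exists s w, [/\ csingleton sr c w,
    rho = halfline (act w (v s))
    & f (halfline (act w (v s))) = Lr rG sr alpha c s w].
  move=> E1 E2; exists s, (u k); split=> //; apply: inj;
    rewrite ?inE ?E2 ?E1 //.
  exact: singleton_ray.
(* A positive root labels the new ray at the step where it becomes an inversion; [- alpha s] labels
   the ray that is given up when the first [s] is read. *)
have [[Pb [k k0 bE]]|[s _ sE]] := fun_ _ Hrho.
  have pb : nonneg (f rho) by apply/nonnegP => s; rewrite bE co_comb.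
  have [j tj jE] := inversion_prefix s0 Hc Hw0 Pb pb.
  by apply: (found _ j.+1 (label j tj).2); rewrite /u Lr_prefixS.
have [k tk [ks sn]] := first_taken s0 Hc Hw0 s.
apply: (found _ k (label k tk).1); rewrite ks -sE /Lr sorting_word_prefix //.
by rewrite (negPf sn).
Qed.
End Bijection.
End Coxeter.

Theorem theorem2p6 (R : realType) (n : nat) (gT : finGroupType) (S : finType)
    (sr : S -> gT) (rG : mx_representation R [set: gT]%G n)
    (alpha v : S -> 'cV[R]_n) (Phi : set 'cV[R]_n) (c : seq S)
    (f : set 'cV[R]_n -> 'cV[R]_n) (rho : set 'cV[R]_n)
    (HW : coxeter_setup rG sr alpha Phi)
    (Hv : fundamental_weights alpha v)
    (Hc : coxeter_word c)
    (Hf : cambrian_bijection rG sr alpha Phi c f)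
    (Hrho : cambrian_rays rG sr alpha c rho) :
  exists! s : S, exists w : gT,
    [/\ csingleton sr c w,
        rho = wact rG w @` halfline (v s)
      & f (wact rG w @` halfline (v s)) = Lr rG sr alpha c s w].
Proof.
have [s [w [sw rhoE fE]]] := ray_of_singleton HW Hv Hf Hc Hrho.
exists s; split=> [|t [w' [_ rhoE' _]]].
  by exists w; rewrite image_halfline.
have E : halfline (wact rG w (v s)) = halfline (wact rG w' (v t)).
  by rewrite -rhoE rhoE' image_halfline.
exact: (ray_type_unique HW Hv E).
Qed.
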